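(* Consider the problem of minimizing $f(x)$ over $x\in\mathbb{R}^n$ subject to $g^{(i)}(x)\le 0$ ($i=1,\dots,m$), $Ax+b=0$, $x\in X$, under the assumptions (a)–(d) and (I1)–(I2) listed in the context. Let $u_0\in D$ and let $(u_k)_{k=0}^\infty\subset D$ be generated by the projected dual gradient method $$u_{k+1}=\mathcal{P}_D[u_k+\alpha\nabla d(u_k)],\quad k\ge0.$$ Let $u^\star\in D^\star$ and $D_0=\{u\in D:\|u-u^\star\|\le\|u_0-u^\star\|\}$. Let $R_0=d^\star-d(u_0)\in(0,\infty)$. If $$0<\alpha<\begin{cases}\dfrac{2}{L(\Psi(D_0))},&\text{if }L(\Psi(D_0))>\eta(D_0),\\[2mm] 4\Bigl(\dfrac{1}{\eta(D_0)}-\dfrac{L(\Psi(D_0))}{2\eta(D_0)^2}\Bigr),&\text{otherwise},\end{cases}$$ then for any $k\ge0$, $$d^\star-d(u_k)\le\frac{R_0}{1+kR_0\delta\rho^{-1}},$$ $$\|\bar{x}(u_k)-x^\star\|\le\left(\frac{2R_0\theta^{-1}}{1+kR_0\delta\rho^{-1}}\right)^{1/2},$$ $$f(\bar{x}(u_k))-f^\star\le(\|u^\star\|+\|u_0-u^\star\|)\left(\frac{2(m+p)L(\Phi(D_0))R_0}{1+kR_0\delta\rho^{-1}}\right)^{1/2}+\frac{R_0}{1+kR_0\delta\rho^{-1}},$$ $$f(\bar{x}(u_k))-f^\star\ge-\|u^\star\|\left(\frac{2L(\Phi(D_0))R_0}{1+kR_0\delta\rho^{-1}}\right)^{1/2},$$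 $$\Delta(\bar{x}(u_k))\le\left(\frac{2L(\Phi(D_0))R_0}{1+kR_0\delta\rho^{-1}}\right)^{1/2},$$ where $\rho=\bigl(\sup_{u\in D_0}\|\nabla d(u)\|+\|u_0-u^\star\|/\alpha\bigr)^2\in(0,\infty)$ and $\delta=1/\alpha-L(\Psi(D_0))/2\in(0,\infty)$.
   Context: Problem data: $f:\mathbb{R}^n\to\mathbb{R}$, $g^{(i)}:\mathbb{R}^n\to\mathbb{R}$ for $i\in\{1,\dots,m\}$, $A\in\mathbb{R}^{p\times n}$, $b\in\mathbb{R}^p$, and $X\subseteq\mathbb{R}^n$ closed and convex. Assumptions: (a) $f$ is strongly convex over $X$ with parameter $\theta>0$: $f(y)-f(x)-s^T(y-x)\ge\frac{\theta}{2}\|x-y\|^2$ for all $x,y\in X$ and all $s\in\partial f(x)$ ($f$ need not be differentiable). (b) Each $g^{(i)}$ is convex over $X$ and there is $L_i>0$ with $|g^{(i)}(x)-g^{(i)}(y)|\le L_i\|x-y\|$ for all $x,y\in X$. (c) There exists $\tilde{x}\in\operatorname{relint}X$ with $g^{(i)}(\tilde{x})<0$ for all $i$ and $A\tilde{x}+b=0$. (d) $m+p\ne0$, and if $p\neq0$ then $A$ is not the zero matrix. Here $\partial$ denotes the subdifferential and $\|\cdot\|$ the Euclidean norm. The problem then has a unique optimal solution $x^\star$, with finite optimal value $f^\star=f(x^\star)$. Lagrangian: $v^{(i)}$ is the $i$th entry of a vector $v$ and $v^{(i:j)}$ the subvector of entries $i,\dots,j$; $\mathcal{L}(x,u)=f(x)+\sum_{i=1}^m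 u^{(i)}g^{(i)}(x)+(u^{(m+1:m+p)})^T(Ax+b)$ for $u\in\mathbb{R}^{m+p}$. Further assumptions: (I1) each $g^{(i)}$ is differentiable at every point of $X$. (I2) There exists $\tilde{u}\in\mathbb{R}^{m+p}$ with $\tilde{u}^{(i)}<0$ for $i=1,\dots,m$ such that $\mathcal{L}(\cdot,\tilde{u})$ is strongly convex over $X$. Such a $\tilde u$ is fixed. Dual: $D=\{u\in\mathbb{R}^{m+p}:u^{(i)}\ge0,\ i=1,\dots,m\}$ and $\tilde{D}=\{u\in\mathbb{R}^{m+p}:u^{(i)}\ge\tilde{u}^{(i)},\ i=1,\dots,m\}\supset D$. For $u\in\tilde{D}$, $\bar{x}(u)$ is the unique minimizer of $\mathcal{L}(\cdot,u)$ over $X$, $d(u)=\min_{x\in X}\mathcal{L}(x,u)$, and the gradient of $d$ at $u$ is $\nabla d(u)=[g^{(1)}(\bar{x}(u)),\dots,g^{(m)}(\bar{x}(u)),(A\bar{x}(u)+b)^T]^T$, with $i$th entry $\nabla^{(i)}d(u)$. The dual problem is to maximize $d$ over $D$; its optimal value is $d^\star$ (and $d^\star=f^\star$), and its set of optimal solutions $D^\star$ is nonempty. The primal infeasibility is $\Delta(x)=\bigl(\|Ax+b\|^2+\sum_{i=1}^m(\max\{0,g^{(i)}(x)\})^2\bigr)^{1/2}$. $\mathcal{P}_D$ is the Euclidean projection onto $D$ and $\operatorname{conv}$ the convex hull. Constants: for $u\in\tilde{D}$, $\gamma(u)=\frac{\sqrt{m+1}}{\theta}\max\{\sigma_{\max}(A),\max_{i\in\{1,\dots,m\}}\|\nabla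 g^{(i)}(\bar{x}(u))\|\}$, where $\sigma_{\max}(A)=\sqrt{\lambda_{\max}(A^TA)}$ ($=0$ if $A$ has a zero dimension). Standing assumption (excluding a trivial case): $\gamma(u)>0$ for all $u\in D$. For compact $S\subset\tilde{D}$, $L(S)=\sup_{u\in S}\gamma(u)\bigl(\sigma_{\max}^2(A)+\sum_{i=1}^mL_i^2\bigr)^{1/2}$. For compact $S\subset D$, $\Phi(S)=\operatorname{conv}\{\mathcal{P}_D[u+\beta\nabla d(u)]:u\in S,\ \beta\in[0,1/L(S)]\}\subset D$. For convex compact $S\subset D$, put $$e(S)=\sup_{u,v\in S}\max_{i\in\{1,\dots,m\}}\frac{-|\nabla^{(i)}d(u)-\nabla^{(i)}d(v)|}{\tilde{u}^{(i)}},\qquad \eta(S)=\begin{cases}e(S),&\text{if }e(S)>0,\\ \sigma_{\max}^2(A)/\theta,&\text{otherwise},\end{cases}$$ and $$\Psi(S)=\begin{cases}\operatorname{conv}\bigl\{u+\beta(\nabla d(u)-\nabla d(v)):u,v\in S,\ \beta\in[0,1/\eta(S)]\bigr\},&\text{if }\eta(S)>0,\\ S,&\text{otherwise}.\end{cases}$$ Then $\Psi(S)$ is compact, $S\subseteq\Psi(S)\subset\tilde{D}$, and $\eta(S)\in[0,\infty)$, $L(\Phi(S)),L(\Psi(S))\in(0,\infty)$. Maxima over an empty index set ($m=0$) are taken to be $0$. *)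

(* Defs.v *)
From HB Require Import structures.
From mathcomp Require Import all_boot all_order all_algebra.
From mathcomp Require Import all_classical all_reals all_analysis.

Set Implicit Arguments.
Unset Strict Implicit.
Unset Printing Implicit Defensive.

Import Order.TTheory GRing.Theory Num.Theory.
Import numFieldNormedType.Exports.

Local Open Scope classical_set_scope.
Local Open Scope ring_scope.

Section Euclidean.
Context {R : realType}.

Definition dot n (u v : 'cV[R]_n) : R := \sum_i u i 0 * v i 0.

(* The library norm `|u| on matrices is the sup norm; it is only used here for
   its topology (closedness, differentiability). *)
Definition enorm n (u : 'cV[R]_n) : R := Num.sqrt (dot u u).

Definition affine_hull n (S : set 'cV[R]_n) : set 'cV[R]_n :=
  [set x | exists k (w : 'I_k -> R) (y : 'I_k -> 'cV[R]_n),
    [/\ \sum_i w i = 1, forall i, S (y i) & x = \sum_i w i *: y i]].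

Definition conv_hull n (S : set 'cV[R]_n) : set 'cV[R]_n :=
  [set x | exists k (w : 'I_k -> R) (y : 'I_k -> 'cV[R]_n),
    [/\ forall i, 0 <= w i, \sum_i w i = 1, forall i, S (y i)
      & x = \sum_i w i *: y i]].

Definition relint n (X : set 'cV[R]_n) : set 'cV[R]_n :=
  [set x | X x /\ exists2 e, 0 < e &
    forall y, affine_hull X y -> enorm (y - x) < e -> X y].

Definition lambda_max n (M : 'M[R]_n) : R := sup [set a | eigenvalue M a].

Definition sigma_max p n (A : 'M[R]_(p, n)) : R :=
  Num.sqrt (lambda_max (A^T *m A)).

Definition gradient n (h : 'cV[R]_n -> R) (x : 'cV[R]_n) : 'cV[R]_n :=
  \col_i ('d h x : 'cV[R]_n -> R) (delta_mx i 0).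

Definition is_minimizer n (h : 'cV[R]_n -> R) (S : set 'cV[R]_n)
    (x : 'cV[R]_n) : Prop :=
  S x /\ forall y, S y -> h x <= h y.

(* The default value 0 is taken when h has no minimizer over S. *)
Definition argmin n (h : 'cV[R]_n -> R) (S : set 'cV[R]_n) : 'cV[R]_n :=
  xget 0 [set x | is_minimizer h S x].

Definition eproj n (S : set 'cV[R]_n) (v : 'cV[R]_n) : 'cV[R]_n :=
  argmin (fun u => enorm (u - v)) S.

(* Subdifferential of h at x relative to X, i.e. of h plus the convex
   indicator of X: convexity is only ever assumed over X. *)
Definition subdiff n (X : set 'cV[R]_n) (h : 'cV[R]_n -> R)
    (x : 'cV[R]_n) : set 'cV[R]_n :=
  [set s | forall y, X y -> h x + dot s (y - x) <= h y].

(* Convexity is stated explicitly: the inequality alone would be vacuous at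
   points where the subdifferential is empty. *)
Definition strongly_convex n (X : set 'cV[R]_n) (h : 'cV[R]_n -> R)
    (theta : R) : Prop :=
  [/\ 0 < theta, convex_function X h
    & forall x y s, X x -> X y -> subdiff X h x s ->
        theta / 2 * enorm (x - y) ^+ 2 <= h y - h x - dot s (y - x)].

(* Lower semicontinuity of the restriction of h to the closed set X; automatic
   for a finite convex function on the whole space. *)
Definition closed_on n (X : set 'cV[R]_n) (h : 'cV[R]_n -> R) : Prop :=
  forall a : R, closed [set x | X x /\ h x <= a].

Definition lipschitz_over n (X : set 'cV[R]_n) (h : 'cV[R]_n -> R)
    (L : R) : Prop :=
  forall x y, X x -> X y -> `|h x - h y| <= L * enorm (x - y).

End Euclidean.

(* minimize f x subject to g i x <= 0 (i < m), A x + b = 0 and x in X *)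
Record problem (R : realType) (n m p : nat) := Problem {
  pf : 'cV[R]_n -> R;
  pg : 'I_m -> 'cV[R]_n -> R;
  pA : 'M[R]_(p, n);
  pb : 'cV[R]_p;
  pX : set 'cV[R]_n }.

Section Dual.
Context {R : realType} {n m p : nat}.
Variable P : problem R n m p.
Local Notation f := (pf P).
Local Notation g := (pg P).
Local Notation A := (pA P).
Local Notation b := (pb P).
Local Notation X := (pX P).

Definition feasible : set 'cV[R]_n :=
  [set x | [/\ X x, forall i, g i x <= 0 & A *m x + b = 0]].

Definition xstar : 'cV[R]_n := argmin f feasible.

Definition fstar : R := f xstar.

Definition Lagr (x : 'cV[R]_n) (u : 'cV[R]_(m + p)) : R :=
  f x + \sum_i usubmx u i 0 * g i x + dot (dsubmx u) (A *m x + b).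

Definition Dset : set 'cV[R]_(m + p) :=
  [set u | forall i, 0 <= usubmx u i 0].

Definition xbar (u : 'cV[R]_(m + p)) : 'cV[R]_n := argmin (Lagr ^~ u) X.

Definition dualf (u : 'cV[R]_(m + p)) : R := inf [set Lagr x u | x in X].

(* Gradient of dualf, by the closed formula valid on the whole of the shifted
   orthant, boundary included. *)
Definition gradd (u : 'cV[R]_(m + p)) : 'cV[R]_(m + p) :=
  col_mx (\col_i g i (xbar u)) (A *m xbar u + b).

Definition dstar : R := sup [set dualf u | u in Dset].

Definition Dstar : set 'cV[R]_(m + p) :=
  [set u | Dset u /\ forall v, Dset v -> dualf v <= dualf u].

Definition infeas (x : 'cV[R]_n) : R :=
  Num.sqrt (enorm (A *m x + b) ^+ 2 + \sum_i Num.max 0 (g i x) ^+ 2).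

(* theta : modulus of strong convexity of f; Lip i : Lipschitz constant of g i;
   ut : the fixed multiplier with Lagr ^~ ut strongly convex. *)
Variables (theta : R) (Lip : 'I_m -> R) (ut : 'cV[R]_(m + p)).

Definition gamma_const (u : 'cV[R]_(m + p)) : R :=
  Num.sqrt m.+1%:R / theta *
  Num.max (sigma_max A)
          (\big[Num.max/0]_(i < m) enorm (gradient (g i) (xbar u))).

(* Extended-real valued, so that an unbounded supremum is +oo. *)
Definition Lconst (S : set 'cV[R]_(m + p)) : \bar R :=
  ereal_sup [set (gamma_const u *
    Num.sqrt (sigma_max A ^+ 2 + \sum_i Lip i ^+ 2))%:E | u in S].

Definition Phi (S : set 'cV[R]_(m + p)) : set 'cV[R]_(m + p) :=
  conv_hull [set v | exists u (beta : R),
    [/\ S u, 0 <= beta, (beta%:E <= (Lconst S)^-1)%E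
      & v = eproj Dset (u + beta *: gradd u)]].

Definition econst (S : set 'cV[R]_(m + p)) : R :=
  sup [set \big[Num.max/0]_(i < m)
         (- `|usubmx (gradd u) i 0 - usubmx (gradd v) i 0| / usubmx ut i 0)
      | u in S & v in S].

Definition eta_const (S : set 'cV[R]_(m + p)) : R :=
  if 0 < econst S then econst S else sigma_max A ^+ 2 / theta.

Definition Psi (S : set 'cV[R]_(m + p)) : set 'cV[R]_(m + p) :=
  if 0 < eta_const S then
    conv_hull [set w | exists u v (beta : R),
      [/\ S u, S v, 0 <= beta <= (eta_const S)^-1
        & w = u + beta *: (gradd u - gradd v)]]
  else S.

End Dual.

(* Main.v *)
Require Import Defs.
From HB Require Import structures.
From mathcomp Require Import all_boot all_order all_algebra.
From mathcomp Require Import all_classical all_reals all_analysis.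
From mathcomp Require Import ring lra.
Import Order.TTheory GRing.Theory Num.Theory.
Import numFieldNormedType.Exports.
Local Open Scope classical_set_scope.
Local Open Scope ring_scope.

(** The dual function d is an infimum of affine functions, so it is concave
    and the constraint values G(xbar(u)) form a supergradient of d at u
    ([dualf_supergradient]).  Everything else rests on a Lipschitz estimate
    for xbar.  First-order optimality of xbar(u) makes the linear functional
    v |-> - <u, G'(xbar(u)) v> a subgradient of f relative to X, whatever the
    signs of u, and strong convexity of f turns this into a quadratic growth
    estimate ([xbar_first_order]).  Adding the estimates at u and at v, and
    using convexity of the constraints for the nonnegative multiplier v only,
    gives |xbar(u) - xbar(v)| <= gamma(u) |u - v| for every u and every v in
    the orthant D ([xbar_lipschitz]); hence the supergradient is Lipschitz
    around points of D, with a constant read off at the other point.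

    A supergradient with such a one-sided Lipschitz bound satisfies the usual
    quadratic lower bound along a segment ([supergradient_descent]) and is
    cocoercive as soon as short steps along differences of supergradients stay
    where the bound holds ([supergradient_cocoercive]).  The set Psi(D0) is
    made of exactly these steps, and the two cases of the step-size condition
    say whether the optimal such step, of length 1/L, is shorter than the
    longest one in Psi(D0), of length 1/eta.  Cocoercivity makes the projected step
    nonexpansive towards ustar, so the iterates stay in the ball D0; the
    quadratic bound yields d(u_{k+1}) >= d(u_k) + delta |u_{k+1} - u_k|^2,
    while concavity bounds the gap d(ustar) - d(u_k) by
    sqrt(rho) |u_{k+1} - u_k|.  Together
    r_{k+1} <= r_k - (delta / rho) r_k^2, which is the O(1/k) rate
    ([sublinear_rate], [dual_rate]).

    The primal statements follow from the dual gap.  Optimality of ustar is a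
    variational inequality on the orthant, that is, the Karush-Kuhn-Tucker
    conditions, so xbar(ustar) is the primal solution and there is no duality
    gap ([xstarE], [fstarE], [dstarE]); the growth of the Lagrangian controls
    the distance to it.  For the infeasibility and the objective one makes a
    trial projected step of length 1/L(Phi(D0)) from u_k: the gain it
    realizes is at most the dual gap, and coordinate by coordinate it bounds
    both the violated constraints and the products - u^(i) G^(i)
    ([projected_step_gain]).  An infinite L(Psi(D0)) contradicts the step-size
    condition; when L(Phi(D0)) is infinite the bounds that involve it
    are trivial. *)

Set Implicit Arguments.
Unset Strict Implicit.
Unset Printing Implicit Defensive.

(** * The Euclidean inner product and norm *)

Section EuclideanSpace.
Context {R : realType}.

Lemma dotC n (u v : 'cV[R]_n) : dot u v = dot v u.
Proof. by apply: eq_bigr => i _; rewrite mulrC. Qed.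

Lemma dotDl n (u v w : 'cV[R]_n) : dot (u + v) w = dot u w + dot v w.
Proof. by rewrite /dot -big_split; apply: eq_bigr => i _; rewrite mxE mulrDl. Qed.

Lemma dotZl n a (u v : 'cV[R]_n) : dot (a *: u) v = a * dot u v.
Proof. by rewrite /dot mulr_sumr; apply: eq_bigr => i _; rewrite mxE mulrA. Qed.

Lemma dotNl n (u v : 'cV[R]_n) : dot (- u) v = - dot u v.
Proof. by rewrite -scaleN1r dotZl mulN1r. Qed.

Lemma dotDr n (u v w : 'cV[R]_n) : dot u (v + w) = dot u v + dot u w.
Proof. by rewrite dotC dotDl !(dotC u). Qed.

Lemma dotZr n a (u v : 'cV[R]_n) : dot u (a *: v) = a * dot u v.
Proof. by rewrite dotC dotZl dotC. Qed.

Lemma dotNr n (u v : 'cV[R]_n) : dot u (- v) = - dot u v.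
Proof. by rewrite dotC dotNl dotC. Qed.

Definition dotE := (@dotDl, @dotDr, @dotNl, @dotNr, @dotZl, @dotZr).

Lemma dot0l n (u : 'cV[R]_n) : dot 0 u = 0.
Proof. by rewrite -(scale0r 0) dotZl mul0r. Qed.

Lemma dot0r n (u : 'cV[R]_n) : dot u 0 = 0.
Proof. by rewrite dotC dot0l. Qed.

Lemma dot_suml n k (a : 'I_k -> R) (s : 'I_k -> 'cV[R]_n) v :
  dot (\sum_i a i *: s i) v = \sum_i a i * dot (s i) v.
Proof.
elim/big_ind2: _ => [|x1 x2 y1 y2 <- <-|i _]; first by rewrite dot0l.
- by rewrite dotDl.
- by rewrite dotZl.
Qed.

Lemma dot_mulmx p n (A : 'M[R]_(p, n)) x y : dot (A *m x) y = dot x (A^T *m y).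
Proof.
have dotE (k : nat) (u v : 'cV[R]_k) : dot u v = (u^T *m v) 0 0.
  by rewrite mxE; apply: eq_bigr => i _; rewrite mxE.
by rewrite !dotE trmx_mul mulmxA.
Qed.

Lemma dot_ge0 n (u : 'cV[R]_n) : 0 <= dot u u.
Proof. by apply: sumr_ge0 => i _; rewrite -expr2 sqr_ge0. Qed.

Lemma dot_eq0 n (u : 'cV[R]_n) : dot u u = 0 -> u = 0.
Proof.
move=> /eqP; rewrite psumr_eq0 => [/allP u0|i _]; last by rewrite -expr2 sqr_ge0.
apply/colP => i; rewrite mxE.
by have := u0 i (mem_index_enum i); rewrite /= mulf_eq0 orbb => /eqP.
Qed.

Lemma dot_col_mx p n (u1 v1 : 'cV[R]_p) (u2 v2 : 'cV[R]_n) :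
  dot (col_mx u1 u2) (col_mx v1 v2) = dot u1 v1 + dot u2 v2.
Proof.
rewrite /dot big_split_ord /=; congr (_ + _); apply: eq_bigr => i _;
  by rewrite ?col_mxEu ?col_mxEd.
Qed.

Lemma dot_submx p n (u v : 'cV[R]_(p + n)) :
  dot u v = dot (usubmx u) (usubmx v) + dot (dsubmx u) (dsubmx v).
Proof. by rewrite -dot_col_mx !vsubmxK. Qed.

Lemma enorm_ge0 n (u : 'cV[R]_n) : 0 <= enorm u.
Proof. exact: sqrtr_ge0. Qed.

Hint Extern 0 (is_true (@Order.le _ _ _ (enorm _))) =>
  solve [apply: enorm_ge0] : core.

Lemma enorm_sq n (u : 'cV[R]_n) : enorm u ^+ 2 = dot u u.
Proof. by rewrite sqr_sqrtr ?dot_ge0. Qed.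

Lemma enormZ n a (u : 'cV[R]_n) : enorm (a *: u) = `|a| * enorm u.
Proof. by rewrite /enorm !dotE mulrA -expr2 sqrtrM ?sqr_ge0// sqrtr_sqr. Qed.

Lemma enormN n (u : 'cV[R]_n) : enorm (- u) = enorm u.
Proof. by rewrite -scaleN1r enormZ normrN1 mul1r. Qed.

Lemma enormB n (u v : 'cV[R]_n) : enorm (u - v) = enorm (v - u).
Proof. by rewrite -opprB enormN. Qed.

Lemma enorm0 n : enorm (0 : 'cV[R]_n) = 0.
Proof. by rewrite /enorm dot0l sqrtr0. Qed.

Lemma enorm_eq0 n (u : 'cV[R]_n) : enorm u = 0 -> u = 0.
Proof. by move=> u0; apply: dot_eq0; rewrite -enorm_sq u0 expr0n. Qed.

Lemma enorm_gt0 n (u : 'cV[R]_n) : u != 0 -> 0 < enorm u.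
Proof.
move=> u0; rewrite lt_def enorm_ge0 andbT.
by apply: contra u0 => /eqP/enorm_eq0->.
Qed.

Lemma norm_dot_le n (u v : 'cV[R]_n) : `|dot u v| <= enorm u * enorm v.
Proof.
rewrite -ler_sqr ?nnegrE ?mulr_ge0// exprMn !enorm_sq real_normK ?num_real//.
have [->|v0] := eqVneq v 0; first by rewrite !dot0r mulr0 expr0n.
have vv : 0 < dot v v by rewrite -enorm_sq exprn_gt0// enorm_gt0.
have := dot_ge0 (dot v v *: u - dot u v *: v).
rewrite !dotE (dotC v u) -(pmulr_rge0 _ vv); set a := dot u u; set b := dot u v.
move=> w0; rewrite -subr_ge0 -(pmulr_rge0 _ (mulr_gt0 vv vv)).
by move: w0; set c := dot v v; congr (_ <= _); ring.
Qed.

Lemma dot_le n (u v : 'cV[R]_n) : dot u v <= enorm u * enorm v.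
Proof. exact: le_trans (ler_norm _) (norm_dot_le _ _). Qed.

Lemma enormD n (u v : 'cV[R]_n) : enorm (u + v) <= enorm u + enorm v.
Proof.
rewrite -ler_sqr ?nnegrE ?addr_ge0// enorm_sq !dotE (dotC v u).
have := dot_le u v; have := enorm_sq u; have := enorm_sq v; nra.
Qed.

Lemma enorm_distD n (w u v : 'cV[R]_n) :
  enorm (u - v) <= enorm (u - w) + enorm (w - v).
Proof. by rewrite -[u - v](subrKA w) enormD. Qed.

Lemma sum_CauchySchwarz k (a b : 'I_k -> R) :
  \sum_i `|a i| * b i <= Num.sqrt (\sum_i a i ^+ 2) * Num.sqrt (\sum_i b i ^+ 2).
Proof.
pose u := \col_i `|a i| : 'cV[R]_k; pose v := \col_i b i : 'cV[R]_k.
have -> : \sum_i `|a i| * b i = dot u v by apply: eq_bigr => i _; rewrite !mxE.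
have -> : \sum_i a i ^+ 2 = dot u u.
  by apply: eq_bigr => i _; rewrite !mxE -expr2 real_normK ?num_real.
have -> : \sum_i b i ^+ 2 = dot v v by apply: eq_bigr => i _; rewrite !mxE.
exact: dot_le.
Qed.

Lemma norm_coord_le n (u : 'cV[R]_n) i : `|u i 0| <= enorm u.
Proof.
rewrite -ler_sqr ?nnegrE// real_normK ?num_real// enorm_sq /dot (bigD1 i)//=.
by rewrite expr2 lerDl sumr_ge0// => j _; rewrite -expr2 sqr_ge0.
Qed.

Lemma enorm_le_col n (u : 'cV[R]_n) c :
  0 <= c -> (forall i, `|u i 0| <= c) -> enorm u <= n%:R * c.
Proof.
move=> c0 uc; rewrite -ler_sqr ?nnegrE ?mulr_ge0// enorm_sq.
apply: (@le_trans _ _ (\sum_(i < n) c ^+ 2)).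
  by apply: ler_sum => i _; rewrite -expr2 -real_normK ?num_real// ler_sqr ?nnegrE.
rewrite sumr_const card_ord exprMn -[_ *+ n]mulr_natl ler_wpM2r ?sqr_ge0//.
by case: n {u uc} => [|n]; rewrite ?expr0n// -natrX ler_nat leq_pmulr.
Qed.

Lemma nbhs_enorm n (x : 'cV[R]_n) e :
  0 < e -> nbhs x [set y | enorm (y - x) < e].
Proof.
move=> e0; apply/nbhs_ballP; exists (e / n.+1%:R); first by rewrite /= divr_gt0.
move=> y [_ xy] /=.
have d0 : 0 < e / n.+1%:R by rewrite divr_gt0.
apply: (@le_lt_trans _ _ (n%:R * (e / n.+1%:R))); last first.
  by rewrite mulrCA gtr_pMr// ltr_pdivrMr// mul1r ltr_nat.
apply: enorm_le_col => [|i]; first exact: ltW.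
by rewrite !mxE distrC ltW//; apply: xy.
Qed.

Lemma trmx_continuous p n :
  continuous (trmx : 'M[R]_(p, n) -> 'M[R]_(n, p)).
Proof.
move=> M A /nbhs_ballP[e e0 eA]; apply/nbhs_ballP; exists e => // N [_ MN].
by apply: eA; split=> // i j; rewrite !mxE; apply: MN.
Qed.

(** Heine-Borel for row vectors, carried over to column vectors by
    transposition. *)
Lemma enorm_bounded_compact n (S : set 'cV[R]_n) c :
  closed S -> (forall x, S x -> enorm x <= c) -> compact S.
Proof.
move=> Scl Sc.
have -> : S = trmx @` (trmx @^-1` S).
  apply/seteqP; split=> [x Sx|_ [x Sx <-]//].
  by exists x^T; rewrite /= trmxK.
apply: continuous_compact.
  by apply: continuous_subspaceT; apply: trmx_continuous.
apply: bounded_closed_compact; last first.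
  apply: closed_comp => // x _; apply: trmx_continuous.
exists c; split; first exact: num_real.
move=> M cM v /= /Sc vc; rewrite -[leLHS]/(mx_norm v) mx_normrE.
have M0 : 0 <= M by apply: le_trans (ltW cM); apply: le_trans vc.
apply/bigmax_leP; split=> // -[i j] _ /=; rewrite ord1.
by apply: le_trans (ltW cM); apply: le_trans vc; have := norm_coord_le v^T j; rewrite mxE.
Qed.

End EuclideanSpace.

(* The order structure is a wildcard, so that the hint fires along every path
   from R to an ordered type. *)
#[global] Hint Extern 0 (is_true (@Order.le _ _ _ (enorm _))) =>
  solve [apply: enorm_ge0] : core.

(** * Minimizers, and the largest singular value *)

Section Minimizers.
Context {R : realType}.

(** The sublevel sets at the values of F on K form a filter base of closed
    sets; a cluster point of the filter belongs to all of them. *)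
Lemma compact_minimum (T : topologicalType) (K : set T) (F : T -> R) :
  compact K -> K !=set0 -> (forall a, closed [set x | K x /\ F x <= a]) ->
  exists x, K x /\ forall y, K y -> F x <= F y.
Proof.
move=> Kco [x0 Kx0] Fcl.
pose B y := [set x | K x /\ F x <= F y].
have Bfilter : Filter (filter_from K B).
  apply: filter_from_filter; first by exists x0.
  move=> i j Ki Kj; have [Fij|/ltW Fji] := leP (F i) (F j).
    by exists i => // x [Kx xi]; split; split=> //; apply: le_trans Fij.
  by exists j => // x [Kx xj]; split; split=> //; apply: le_trans Fji.
have Bproper : ProperFilter (filter_from K B).
  by apply: filter_from_proper => // y Ky; exists y.
have [|x [Kx xB]] := Kco _ Bproper; first by exists x0 => // x [].
exists x; split=> // y Ky; suff [] : B y x by [].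
by apply: (Fcl (F y)) => C Cx; apply: xB => //; apply: in_filter_from.
Qed.

(** Continuity of k relative to X, in terms of the Euclidean norm rather than
    of the sup norm that carries the topology. *)
Definition enorm_continuous n (X : set 'cV[R]_n) (k : 'cV[R]_n -> R) :=
  forall x, X x -> forall e, 0 < e ->
  exists2 d, 0 < d & forall y, X y -> enorm (y - x) < d -> `|k y - k x| <= e.

Lemma lipschitz_enorm_continuous n (X : set 'cV[R]_n) k L :
  lipschitz_over X k L -> enorm_continuous X k.
Proof.
move=> kL x Xx e e0; exists (e / (1 + `|L|)).
  by rewrite divr_gt0// ltr_pwDl.
move=> y Xy; rewrite ltr_pdivlMr ?ltr_pwDl// => xy; apply: le_trans (kL _ _ Xy Xx) _.
by have := ler_norm L; have := enorm_ge0 (y - x); nra.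
Qed.

Lemma sqr_dist_enorm_continuous n (X : set 'cV[R]_n) x0 :
  enorm_continuous X (fun y => enorm (y - x0) ^+ 2).
Proof.
move=> x Xx e e0; set c := enorm (x - x0).
have c0 : 0 <= c := enorm_ge0 _.
pose d := Num.min 1 (e / (1 + 2 * c)).
have ec0 : 0 < 1 + 2 * c by rewrite ltr_pwDl// mulr_ge0.
exists d; first by rewrite lt_min ltr01 divr_gt0.
move=> y Xy; rewrite lt_min ltr_pdivlMr// => /andP[y1 ye].
have := enorm_distD y x x0; rewrite (enormB x y) -/c.
have := enorm_distD x y x0; rewrite -/c.
have := enorm_ge0 (y - x); have := enorm_ge0 (y - x0).
move: y1 ye; set r := enorm (y - x); set s := enorm (y - x0) => y1 ye s0 r0 h1 h2.
have rsc : r * (s + c) <= r * (1 + 2 * c) by rewrite ler_wpM2l//; lra.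
rewrite subr_sqr normrM (ger0_norm (addr_ge0 s0 c0)).
apply: le_trans (le_trans rsc (ltW ye)).
by rewrite ler_wpM2r ?addr_ge0// ler_norml; apply/andP; split; lra.
Qed.

Lemma closed_on_cst n (X : set 'cV[R]_n) c : closed X -> closed_on X (fun=> c).
Proof.
move=> Xcl a; have [ca|ac] := leP c a.
  by rewrite (_ : mkset _ = X)//; apply/seteqP; split=> [x []//|x].
rewrite (_ : mkset _ = set0); first exact: closed0.
by apply/seteqP; split=> // x [].
Qed.

(** Lower semicontinuity of h, in the form of closed sublevel sets, survives
    a continuous perturbation. *)
Lemma closed_onD n (X : set 'cV[R]_n) h k :
  closed X -> closed_on X h -> enorm_continuous X k ->
  closed_on X (fun x => h x + k x).
Proof.
move=> Xcl hcl kc a x xcl.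
have Xx : X x by apply: Xcl => C /xcl[y [[Xy _] Cy]]; exists y.
split=> //; rewrite leNgt; apply/negP => ax.
pose e := (h x + k x - a) / 3.
have e0 : 0 < e by rewrite divr_gt0// subr_gt0.
have [d d0 kd] := kc x Xx e e0.
have : nbhs x (~` [set y | X y /\ h y <= h x - e]).
  apply: open_nbhs_nbhs; split; first exact/closed_openC/hcl.
  by move=> [_]; rewrite lerBrDr gerDl leNgt e0.
move=> /(filterI (nbhs_enorm x d0))/xcl[y [[Xy ya] [yx yh]]].
have {}yh : h x - e < h y by rewrite ltNge; apply/negP => ?; apply: yh.
have := kd y Xy yx; rewrite ler_norml => /andP[ke _].
by move: e0 yh ke ya ax; rewrite /e; lra.
Qed.

(** The quadratic lower bound confines a sublevel set to a ball, where
    [compact_minimum] applies. *)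
Lemma coercive_minimizer n (X : set 'cV[R]_n) (F : 'cV[R]_n -> R) x1 c K th :
  closed_on X F -> X x1 -> 0 < th ->
  (forall y, X y ->
     c - K * enorm (y - x1) + th * enorm (y - x1) ^+ 2 <= F y) ->
  exists x, is_minimizer F X x.
Proof.
move=> Fcl Xx1 th0 FK.
pose S := [set x | X x /\ F x <= F x1].
pose M : R := `|F x1 - c| + `|K|.
have SM y : S y -> enorm y <= 1 + M / th + enorm x1.
  move=> [Xy yx1].
  have : enorm (y - x1) <= 1 + M / th.
    have [r1|r1] := leP (enorm (y - x1)) 1.
      by rewrite ler_wpDr// divr_ge0 ?addr_ge0// ltW.
    rewrite ler_wpDl// ler_pdivlMr//.
    have := FK y Xy; move: r1 => /[dup] r1; set r := enorm (y - x1) => r1' FKy.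
    have r0 : 0 < r by lra.
    rewrite -(ler_pM2r r0).
    have h1 := ler_norm (F x1 - c); have h2 := ler_norm K.
    have h3 := normr_ge0 (F x1 - c).
    by rewrite /M; nra.
  by have := enorm_distD x1 y 0; rewrite !subr0; lra.
have [||a|x [[Xx xx1] xmin]] := @compact_minimum _ S F.
- exact: enorm_bounded_compact (Fcl _) SM.
- by exists x1; split.
- rewrite (_ : mkset _ = [set x | X x /\ F x <= Num.min (F x1) a]) => [//|].
  apply/seteqP; split=> x /=; rewrite le_min.
    by move=> [[Xx h1] h2]; split=> //; apply/andP.
  by move=> [Xx /andP[h1 h2]].
exists x; split=> // y Xy; have [yx1|x1y] := leP (F y) (F x1).
  by apply: xmin; split.
exact: le_trans xx1 (ltW x1y).
Qed.

Lemma argminP n (h : 'cV[R]_n -> R) S :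
  (exists x, is_minimizer h S x) -> is_minimizer h S (argmin h S).
Proof. by move=> [x hx]; apply: (xgetPex 0); exists x. Qed.

Lemma dot_mulmx_sqr p n (A : 'M[R]_(p, n)) (x : 'cV[R]_n) :
  dot x (A^T *m A *m x) = enorm (A *m x) ^+ 2.
Proof. by rewrite enorm_sq dot_mulmx mulmxA. Qed.

Lemma mulmx_bound p n (A : 'M[R]_(p, n)) :
  exists2 K, 0 <= K & forall x, enorm (A *m x) <= K * enorm x.
Proof.
pose M : R := \sum_i \sum_j `|A i j|.
have M0 : 0 <= M by apply: sumr_ge0 => k _; exact: sumr_ge0.
exists (p%:R * M); first exact: mulr_ge0.
move=> x.
rewrite -mulrA; apply: enorm_le_col; first exact: mulr_ge0.
move=> i; rewrite mxE; apply: le_trans (ler_norm_sum _ _ _) _.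
apply: (@le_trans _ _ (\sum_j `|A i j| * enorm x)).
  by apply: ler_sum => j _; rewrite normrM ler_wpM2l// norm_coord_le.
rewrite -mulr_suml ler_wpM2r// /M (bigD1 i)//= lerDl.
by apply: sumr_ge0 => k _; exact: sumr_ge0.
Qed.

(** The eigenvalue is the maximum of |A y|^2 on the unit sphere, attained at
    some z.  The form l |y|^2 - |A y|^2 is then nonnegative and vanishes at
    z, so z belongs to its kernel, that is, to the eigenspace of l. *)
Lemma rayleigh_maximum p n (A : 'M[R]_(p, n)) (x : 'cV[R]_n) : x != 0 ->
  exists2 l, eigenvalue (A^T *m A) l
    & forall y, enorm (A *m y) ^+ 2 <= l * enorm y ^+ 2.
Proof.
move=> x_neq0; have [K K0 AK] := mulmx_bound A.
pose S := [set y : 'cV[R]_n | enorm y = 1].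
have Tcl : closed (@setT 'cV[R]_n) by exact: closedT.
have normL (c : R) : lipschitz_over setT (fun y : 'cV[R]_n => c * enorm y) `|c|.
  move=> y z _ _; rewrite -mulrBr normrM ler_wpM2l//.
  have := enorm_distD y z 0; have := enorm_distD z y 0.
  by rewrite !subr0 (enormB z) ler_norml; lra.
have ncl (c : R) : closed_on setT (fun y : 'cV[R]_n => 0 + c * enorm y).
  apply: closed_onD => //; first exact: closed_on_cst.
  exact: lipschitz_enorm_continuous (normL c).
have Scl : closed S.
  have := closedI (ncl 1 1) (ncl (-1) (-1)); congr closed.
  apply/seteqP; split=> y /=; rewrite /S/=; last by move=> ->; lra.
  by move=> [[_ ?] [_ ?]]; apply/eqP; rewrite eq_le; lra.
pose F y := - enorm (A *m y) ^+ 2.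
have Fc : enorm_continuous S F.
  move=> y Sy e e0; have [d d0 h] := @sqr_dist_enorm_continuous _ setT 0 (A *m y) I e e0.
  exists (d / (1 + K)) => [|z _]; first by rewrite divr_gt0// ltr_pwDl.
  rewrite ltr_pdivlMr ?ltr_pwDl// => zy.
  have := h (A *m z) I; rewrite /F !subr0 -mulmxBr -opprD normrN; apply.
  by apply: le_lt_trans (AK _) _; have := enorm_ge0 (z - y); nra.
have [|||z [Sz zmin]] := @compact_minimum _ S F.
- by apply: (@enorm_bounded_compact _ _ _ 1) => // y ->.
- exists ((enorm x)^-1 *: x); rewrite /S /= enormZ ger0_norm ?invr_ge0//.
  by rewrite mulVf// gt_eqF// enorm_gt0.
- move=> a; have Fcl : closed_on S (fun y => 0 + F y).
    by apply: closed_onD => //; exact: closed_on_cst.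
  by have := Fcl a; congr closed; apply/seteqP; split=> y /=; rewrite add0r.
pose l := enorm (A *m z) ^+ 2.
have lmax y : enorm (A *m y) ^+ 2 <= l * enorm y ^+ 2.
  have [->|y0] := eqVneq y 0; first by rewrite mulmx0 !enorm0 expr0n mulr0.
  have ny := enorm_gt0 y0.
  have := zmin ((enorm y)^-1 *: y).
  rewrite /S/= /F -scalemxAr !enormZ ger0_norm ?invr_ge0// mulVf ?gt_eqF//.
  move=> /(_ erefl); rewrite lerN2 exprMn exprVn -/l mulrC.
  by rewrite ler_pdivrMr// exprn_gt0.
exists l => //.
have zz : dot z z = 1 by rewrite -enorm_sq Sz expr1n.
have [w wE] : exists w, w = l *: z - A^T *m A *m z by eexists.
have wv v : dot w v = l * dot z v - dot (A *m z) (A *m v).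
  by rewrite wE dotDl dotZl dotNl -mulmxA dot_mulmx trmxK.
have lE : dot (A *m z) (A *m z) = l by rewrite -enorm_sq.
have zw : dot z w = 0 by rewrite dotC wv lE zz mulr1 subrr.
have AzAw : dot (A *m z) (A *m w) = - dot w w by rewrite wv zw; ring.
have quad t : 0 <= 2 * t * dot w w + t ^+ 2 * (l * dot w w - enorm (A *m w) ^+ 2).
  have := lmax (z + t *: w).
  rewrite !enorm_sq mulmxDr -scalemxAr !dotE (dotC (A *m w) (A *m z)) (dotC w z).
  by rewrite lE AzAw zz zw; lra.
have w0 : w = 0.
  apply: dot_eq0; set a := dot w w in quad *.
  set b := l * a - _ in quad.
  have a0 : 0 <= a by exact: dot_ge0.
  (* small enough for the quadratic term of quad not to dominate *)
  pose t := - a / (1 + `|b|).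
  have den : 0 < 1 + `|b| by rewrite ltr_pwDl.
  have ht : t * (1 + `|b|) = - a by rewrite divfK// gt_eqF.
  have := quad t; have := ler_norm b; have := normr_ge0 b => b0 bb qt.
  have t0 : t <= 0 by nra.
  have : 2 * t * a + t ^+ 2 * b <= t * a by nra.
  nra.
apply/eigenvalueP; exists z^T; last first.
  apply/eqP => /(congr1 trmx); rewrite trmxK trmx0 => z0.
  by move: zz; rewrite z0 dot0l; lra.
apply: trmx_inj; rewrite trmx_mul !linearZ/= !trmx_mul !trmxK.
by apply/esym/subr0_eq; rewrite -wE.
Qed.

Lemma sigma_max_ge0 p n (A : 'M[R]_(p, n)) : 0 <= sigma_max A.
Proof. exact: sqrtr_ge0. Qed.

(** By [rayleigh_maximum] the spectrum contains an upper bound of the Rayleigh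
    quotients, and these bound the spectrum in turn. *)
Lemma sigma_max_bound p n (A : 'M[R]_(p, n)) (x : 'cV[R]_n) :
  enorm (A *m x) <= sigma_max A * enorm x.
Proof.
have [->|x0] := eqVneq x 0; first by rewrite mulmx0 !enorm0 mulr0.
have [l eig_l lmax] := rayleigh_maximum A x0.
have l0 : 0 <= l.
  rewrite -(pmulr_lge0 _ (exprn_gt0 2 (enorm_gt0 x0))).
  by apply: le_trans (lmax x); rewrite sqr_ge0.
rewrite -ler_sqr ?nnegrE ?mulr_ge0 ?sigma_max_ge0// exprMn.
apply: le_trans (lmax x) _; rewrite ler_wpM2r ?sqr_ge0//.
have lle : l <= lambda_max (A^T *m A).
  apply: (@ub_le_sup _ [set a | eigenvalue (A^T *m A) a]) => //.
  exists l => a /eigenvalueP[v va v0].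
  have {}va : A^T *m A *m v^T = a *: v^T.
    apply: trmx_inj; rewrite !trmx_mul !trmxK linearZ/= trmxK -va.
    by rewrite mulmxA.
  have := lmax v^T; rewrite -dot_mulmx_sqr va dotE -enorm_sq ler_pM2r//.
  rewrite exprn_gt0// enorm_gt0//; apply: contra v0 => /eqP/(congr1 trmx).
  by rewrite trmxK trmx0 => ->.
by rewrite sqr_sqrtr// (le_trans l0).
Qed.

End Minimizers.

(** * Convexity and first-order conditions *)

Section Convexity.
Context {R : realType} {n : nat}.
Implicit Types (X : set 'cV[R]_n) (h k : 'cV[R]_n -> R) (x y v : 'cV[R]_n).

Lemma segmentE (V : lmodType R) (x y : V) (t : R) : x + t *: (y - x) = t *: y + (1 - t) *: x.
Proof. by rewrite scalerBr scalerBl scale1r addrCA. Qed.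

Lemma convex_set_segment X x y (t : R) : convex_set X -> X x -> X y ->
  0 <= t -> t <= 1 -> X (x + t *: (y - x)).
Proof.
move=> cX Xx Xy t0 t1.
have := cX y x (Itv01 t0 t1) (mem_set Xy) (mem_set Xx); rewrite inE.
by rewrite segmentE.
Qed.

Lemma convex_function_segment X h x y (t : R) : convex_function X h ->
  X x -> X y -> 0 <= t -> t <= 1 ->
  h (x + t *: (y - x)) <= h x + t * (h y - h x).
Proof.
move=> ch Xx Xy t0 t1.
have := ch (Itv01 t0 t1) y x (mem_set Xy) (mem_set Xx).
rewrite segmentE => /le_trans; apply.
by rewrite convRE/= /unstable.onem; lra.
Qed.

Definition slope k x v (t : R) := t^-1 * (k (x + t *: v) - k x).

(** Convexity of h is weighed against the one-sided slope of k at the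
    minimizer, so k may be any combination of the constraints, negative
    multipliers included. *)
Lemma minimizer_slope X h k x y D : convex_set X -> convex_function X h ->
  is_minimizer (fun z => h z + k z) X x -> X y ->
  slope k x (y - x) @ 0^'+ --> D -> h x - h y <= D.
Proof.
move=> cX ch [Xx xmin] Xy kD; apply: cvgr_to_ge kD _; near=> t.
have t0 : 0 < t by [].
have t1 : t <= 1 by near: t; apply: nbhs_right_le.
rewrite /slope ler_pdivlMl//.
have := xmin _ (convex_set_segment cX Xx Xy (ltW t0) t1).
have := convex_function_segment ch Xx Xy (ltW t0) t1.
lra.
Unshelve. all: by end_near. Qed.

Lemma gradientE k x v : dot (gradient k x) v = 'd k x v.
Proof.
rewrite [in RHS](_ : v = \sum_i v i 0 *: delta_mx i 0).
  by rewrite linear_sum; apply: eq_bigr => i _; rewrite linearZ/= mxE mulrC.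
apply: trmx_inj; rewrite [LHS]row_sum_delta linear_sum/=.
by apply: eq_bigr => i _; rewrite linearZ/= trmx_delta mxE.
Qed.

Lemma cvg_slope_differentiable k x v : differentiable k x ->
  slope k x v @ 0^'+ --> dot (gradient k x) v.
Proof.
move=> dk; rewrite gradientE -deriveE//.
apply: cvg_dnbhs_at_right; have := @diff_derivable _ _ _ _ _ v dk.
rewrite /derivable /derive; set F := (F in F @ _) => Fc.
apply: cvg_trans Fc; apply: near_eq_cvg; apply: nearW => t.
by rewrite /slope /F /= (addrC x).
Qed.

Lemma gradient_inequality X k x y : convex_set X -> convex_function X k ->
  differentiable k x -> X x -> X y ->
  dot (gradient k x) (y - x) <= k y - k x.
Proof.
move=> cX ck dk Xx Xy.
apply: cvgr_to_le (cvg_slope_differentiable dk) _; near=> t.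
have t0 : 0 < t by [].
have t1 : t <= 1 by near: t; apply: nbhs_right_le.
have := convex_function_segment ck Xx Xy (ltW t0) t1.
rewrite /slope ler_pdivrMl//; lra.
Unshelve. all: by end_near. Qed.

Lemma cvg_slope_comb m p (g : 'I_m -> 'cV[R]_n -> R) (A : 'M[R]_(p, n)) b
    (a : 'I_m -> R) (c : 'cV[R]_p) x v :
  (forall i, differentiable (g i) x) ->
  slope (fun z => \sum_i a i * g i z + dot c (A *m z + b)) x v @ 0^'+ -->
    \sum_i a i * dot (gradient (g i) x) v + dot c (A *m v).
Proof.
move=> dg.
pose F t := \sum_i a i * slope (g i) x v t + dot c (A *m v).
have : F @ 0^'+ --> \sum_i a i * dot (gradient (g i) x) v + dot c (A *m v).
  apply: cvgD; last exact: cvg_cst.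
  apply: cvg_big => [|i _]; first exact: add_continuous.
  by apply: cvgMl_tmp; apply: cvg_slope_differentiable.
apply: cvg_trans; apply: near_eq_cvg; near=> t.
have t0 : 0 < t by [].
rewrite /F /slope mulmxDr -scalemxAr !dotE.
under eq_bigr do rewrite mulrCA mulrBr.
rewrite -mulr_sumr sumrB; set s1 := \sum_i _; set s2 := \sum_i _.
by field; rewrite gt_eqF.
Unshelve. all: by end_near. Qed.

Lemma cvg_slope_sqr_dist x0 x v :
  slope (fun y => enorm (y - x0) ^+ 2) x v @ 0^'+ --> 2 * dot (x - x0) v.
Proof.
pose F (t : R) := 2 * dot (x - x0) v + t * dot v v.
have : F @ 0^'+ --> 2 * dot (x - x0) v.
  rewrite -[X in _ --> X]addr0 -[X in _ + X](mul0r (dot v v)).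
  apply: cvg_dnbhs_at_right; apply: cvg_within_filter.
  by apply: cvgD; [exact: cvg_cst|apply: cvgMr_tmp; exact: cvg_id].
apply: cvg_trans; apply: near_eq_cvg; near=> t.
have t0 : 0 < t by [].
rewrite /F /slope !enorm_sq addrAC [in RHS](dotDl (x - x0)) !dotE.
rewrite !(dotC v); field.
by rewrite gt_eqF.
Unshelve. all: by end_near. Qed.

(** A minimizer of h + |. - x0|^2 provides a subgradient, by the first-order
    condition at that point.  The minimizer exists because h decreases at
    most linearly: h is bounded below on the unit ball around x0, and
    convexity propagates this bound along the rays from x0. *)
Lemma exists_subgradient X h x0 : closed X -> convex_set X ->
  convex_function X h -> closed_on X h -> X x0 ->
  exists x s, X x /\ subdiff X h x s.
Proof.
move=> Xcl cX ch hcl Xx0.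
pose q y : R := enorm (y - x0) ^+ 2.
have ncl : closed_on X (fun y => 0 + q y).
  apply: closed_onD => //; first exact: closed_on_cst.
  exact: sqr_dist_enorm_continuous.
pose S := [set y | X y /\ 0 + q y <= 1].
have Sco : compact S.
  apply: (enorm_bounded_compact (c := 1 + enorm x0) (ncl 1)) => y [_].
  rewrite add0r -[leRHS](expr1n _ 2) ler_sqr ?nnegrE// => yx0.
  by have := enorm_distD x0 y 0; rewrite !subr0; lra.
have [|a|z [[Xz _] zmin]] := @compact_minimum _ _ S h Sco.
- by exists x0; split; rewrite // /q subrr enorm0 expr0n addr0.
- have := closedI (ncl 1) (hcl a); congr closed; apply/seteqP; split=> y /=.
    by move=> [[Xy h1] [_ h2]]; split.
  by move=> [[Xy h1] h2].
have hgrowth y : X y ->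
    h z - (h x0 - h z) * enorm (y - x0) + 1 * enorm (y - x0) ^+ 2 <= h y + q y.
  move=> Xy; rewrite mul1r lerD2r.
  have zx0 : h z <= h x0.
    by apply: zmin; split; rewrite // /q subrr enorm0 expr0n addr0.
  have r0 := enorm_ge0 (y - x0).
  have [r1|r1] := leP (enorm (y - x0)) 1.
    have : h z <= h y by apply: zmin; split; rewrite // add0r expr_le1.
    nra.
  have rp : 0 < enorm (y - x0) by lra.
  pose t := (enorm (y - x0))^-1.
  have t0 : 0 <= t by rewrite invr_ge0.
  have t1 : t <= 1 by rewrite invf_le1// ltW.
  have tr : enorm (y - x0) * t = 1 by rewrite divff// gt_eqF.
  have := convex_function_segment ch Xx0 Xy t0 t1.
  have : h z <= h (x0 + t *: (y - x0)).
    apply: zmin; split; first exact: convex_set_segment.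
    by rewrite add0r /q addrC addKr enormZ ger0_norm// mulrC tr expr1n.
  move=> h1 h2; have := le_trans h1 h2; move: t0 t1 tr r1; clear h1 h2.
  set r := enorm _ => t0 t1 tr r1 h3.
  have : r * h z <= r * (h x0 + t * (h y - h x0)) by rewrite ler_wpM2l.
  rewrite mulrDr mulrA tr; nra.
have [|x xmin] := coercive_minimizer _ Xx0 ltr01 hgrowth.
  by apply: closed_onD => //; exact: sqr_dist_enorm_continuous.
exists x, (- 2 *: (x - x0)); split; first by case: xmin.
move=> y Xy; rewrite dotZl.
have := minimizer_slope cX ch xmin Xy (@cvg_slope_sqr_dist x0 x (y - x)).
lra.
Qed.

(** Strong convexity is only assumed where subgradients exist, hence the need
    for [exists_subgradient]. *)
Lemma strongly_convex_growth X h th x0 : closed X -> convex_set X ->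
  strongly_convex X h th -> closed_on X h -> X x0 ->
  exists x s, X x /\ forall y, X y ->
    h x + dot s (y - x) + th / 2 * enorm (y - x) ^+ 2 <= h y.
Proof.
move=> Xcl cX [_ ch hsc] hcl Xx0.
have [x [s [Xx xs]]] := exists_subgradient Xcl cX ch hcl Xx0.
exists x, s; split=> // y Xy; have := hsc x y s Xx Xy xs.
rewrite enormB; lra.
Qed.

End Convexity.

(** * Concave functions with a Lipschitz supergradient *)

Section Supergradients.
Context {R : realType} {n : nat}.
Variables (q : 'cV[R]_n -> R) (s : 'cV[R]_n -> 'cV[R]_n).
Hypothesis q_super : forall z w, q w <= q z + dot (s z) (w - z).

(** Replaces integration of the derivative along the segment: concavity at
    the right end of each of N equal pieces bounds the increment below, the
    Lipschitz hypothesis compares the supergradients with s u, and the sum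
    overshoots the integral by a term of order 1/N. *)
Lemma supergradient_descent (u w : 'cV[R]_n) (l : R) :
  (forall t : R, 0 <= t -> t <= 1 ->
     enorm (s (u + t *: (w - u)) - s u) <= l * (t * enorm (w - u))) ->
  q u + dot (s u) (w - u) - l / 2 * enorm (w - u) ^+ 2 <= q w.
Proof.
move=> slip; set v := w - u in slip *.
pose a : R := dot (s u) v; pose c : R := l * enorm v ^+ 2.
(* the bound after j of the N + 1 pieces; j (j + 1) / 2 sums 1, ..., j *)
have step (N j : nat) : (j <= N.+1)%N ->
    q u + j%:R / N.+1%:R * a
        - c / 2 * (j%:R * (j%:R + 1)) / N.+1%:R ^+ 2
      <= q (u + (j%:R / N.+1%:R) *: v).
  have N0 : 0 < N.+1%:R :> R by rewrite ltr0n.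
  elim: j => [_|j IHj jN].
    by rewrite !mul0r !mulr0 mul0r subr0 addr0 scale0r addr0.
  have {}IHj := IHj (ltnW jN).
  set t' := j.+1%:R / N.+1%:R : R.
  have t'0 : 0 <= t' by rewrite divr_ge0.
  have t'1 : t' <= 1 by rewrite ler_pdivrMr// mul1r ler_nat.
  have := q_super (u + t' *: v) (u + (j%:R / N.+1%:R) *: v).
  have -> : u + (j%:R / N.+1%:R) *: v - (u + t' *: v) = - N.+1%:R^-1 *: v.
    rewrite opprD addrACA subrr add0r -scalerBl; congr (_ *: _).
    by rewrite /t' -natr1; field; rewrite gt_eqF.
  rewrite dotZr => qj.
  have /(le_trans (dot_le _ _)) : enorm (s u - s (u + t' *: v)) * enorm v <= t' * c.
    rewrite enormB /c; have := ler_wpM2r (enorm_ge0 v) (slip _ t'0 t'1); lra.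
  rewrite dotDl dotNl -/a => sa.
  have NV : 0 < N.+1%:R^-1 :> R by rewrite invr_gt0.
  have e1 : t' = (j%:R + 1) / N.+1%:R by rewrite /t' natr1.
  move: IHj qj sa; rewrite e1 -(natr1 j) -exprVn.
  set M : R := N.+1%:R^-1 in NV *; set J : R := j%:R; set x := dot _ v.
  set q1 := q (u + (J * M) *: v); set q2 := q _.
  move=> IHj qj sa; have : M * (a - x) <= M * ((J + 1) * M * c) by rewrite ler_pM2l.
  nra.
have lim (N : nat) : q u + a - c / 2 - q w <= c / 2 / N.+1%:R.
  have := step N N.+1 (leqnn _); rewrite divff ?pnatr_eq0// scale1r mul1r.
  have -> : u + v = w by rewrite addrC subrK.
  have : N.+1%:R != 0 :> R by rewrite pnatr_eq0.
  set M : R := N.+1%:R => M0.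
  have -> : c / 2 * (M * (M + 1)) / M ^+ 2 = c / 2 + c / 2 / M by field.
  by move: (c / 2 / M) => e; lra.
rewrite mulrAC -/c -/a -subr_le0 leNgt; apply/negP => b0.
set b := _ - q w in b0.
(* N > c / (2 b) contradicts the bound lim N *)
pose N := Num.Def.truncn (c / 2 / b).
have := lim N; rewrite -/b leNgt => /negP; apply.
rewrite ltr_pdivrMr ?ltr0n// (mulrC b) -ltr_pdivrMr//.
exact: truncnS_gt.
Qed.

(** From u move by beta (s u - s v).  The quadratic bound of
    [supergradient_descent] and the affine upper bound of q at v enclose the
    value of q there; exchanging u and v and adding gives the claim. *)
Lemma supergradient_cocoercive (u v : 'cV[R]_n) (beta l : R) : 0 <= beta ->
  (forall t : R, 0 <= t -> t <= 1 ->
     enorm (s (u + t *: (beta *: (s u - s v))) - s u)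
       <= l * (t * enorm (beta *: (s u - s v)))) ->
  (forall t : R, 0 <= t -> t <= 1 ->
     enorm (s (v + t *: (beta *: (s v - s u))) - s v)
       <= l * (t * enorm (beta *: (s v - s u)))) ->
  (2 * beta - l * beta ^+ 2) * enorm (s u - s v) ^+ 2
    <= - dot (s u - s v) (u - v).
Proof.
have half x y : 0 <= beta ->
  (forall t : R, 0 <= t -> t <= 1 ->
     enorm (s (x + t *: (beta *: (s x - s y))) - s x)
       <= l * (t * enorm (beta *: (s x - s y)))) ->
  (beta - l / 2 * beta ^+ 2) * enorm (s x - s y) ^+ 2
    <= q y - q x + dot (s y) (x - y).
  move=> b0; set e := s x - s y => slip.
  have := @supergradient_descent x (x + beta *: e) l.
  rewrite addrC addKr => /(_ slip) h1.
  have := q_super y (x + beta *: e); rewrite (addrAC x) => h2.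
  have := le_trans h1 h2; rewrite enormZ exprMn real_normK ?num_real//.
  rewrite !dotDr !dotZr.
  have : dot (s x) e - dot (s y) e = enorm e ^+ 2 by rewrite enorm_sq dotDl dotNl.
  move: (enorm e ^+ 2) => E <-; lra.
move=> b0 /(half u v b0) h1 /(half v u b0) h2.
move: h1 h2; rewrite (enormB (s v)) !dotDl !dotNl !dotDr !dotNr; lra.
Qed.

End Supergradients.

(** * Projection onto the orthant and gains of a projected step *)

Section Projection.
Context {R : realType} {m p : nat}.
Implicit Types v w : 'cV[R]_(m + p).

Definition orthant_proj v : 'cV[R]_(m + p) :=
  col_mx (\col_i Num.max 0 (usubmx v i 0)) (dsubmx v).

Lemma usubmx_orthant_proj v i :
  usubmx (orthant_proj v) i 0 = Num.max 0 (usubmx v i 0).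
Proof. by rewrite col_mxKu mxE. Qed.

Lemma orthant_proj_D v : Dset (orthant_proj v).
Proof. by move=> i; rewrite usubmx_orthant_proj le_max lexx. Qed.

Lemma orthant_proj_obtuse v w : Dset w ->
  dot (v - orthant_proj v) (w - orthant_proj v) <= 0.
Proof.
move=> Dw; rewrite dot_submx !linearB/= col_mxKd subrr dot0l addr0.
apply: sumr_le0 => i _; have := Dw i; have := usubmx_orthant_proj v i.
move: (usubmx v) (usubmx w) (usubmx (orthant_proj v)) => a b c.
rewrite !mxE => -> bi.
by case: (leP 0 (a i 0)) => ai; nra.
Qed.

(** The obtuse angle criterion gives a Pythagorean inequality, so the
    clipped vector is the only nearest point. *)
Lemma eprojE v : eproj Dset v = orthant_proj v.
Proof.
have pyth w : Dset w ->
    enorm (orthant_proj v - v) ^+ 2 + enorm (w - orthant_proj v) ^+ 2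
      <= enorm (w - v) ^+ 2.
  move=> Dw; have := orthant_proj_obtuse v Dw.
  rewrite !enorm_sq -[w - v](subrKA (orthant_proj v)).
  rewrite -[v - _]opprB.
  move: (w - orthant_proj v) (orthant_proj v - v) => c d.
  rewrite !dotE (dotC c d); lra.
have [Du umin] : is_minimizer (fun u => enorm (u - v)) Dset (eproj Dset v).
  apply: argminP; exists (orthant_proj v); split; first exact: orthant_proj_D.
  move=> w Dw; rewrite -ler_sqr ?nnegrE//; have := pyth w Dw.
  by have := sqr_ge0 (enorm (w - orthant_proj v)); lra.
apply/eqP; rewrite -subr_eq0; apply/eqP/enorm_eq0/eqP.
rewrite -sqrf_eq0 eq_le sqr_ge0 andbT.
have := umin _ (orthant_proj_D v); rewrite -ler_sqr ?nnegrE//.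
by have := pyth _ Du; lra.
Qed.

Lemma eproj_D v : Dset (eproj Dset v).
Proof. by rewrite eprojE; apply: orthant_proj_D. Qed.

Lemma eproj_obtuse v w : Dset w ->
  dot (v - eproj Dset v) (w - eproj Dset v) <= 0.
Proof. by rewrite eprojE; apply: orthant_proj_obtuse. Qed.

Lemma eproj_id v : Dset v -> eproj Dset v = v.
Proof.
move=> Dv; rewrite eprojE -[RHS]vsubmxK; congr col_mx.
by apply/colP => i; rewrite mxE max_r//; apply: Dv.
Qed.

Lemma Dset_segment v w (t : R) : Dset v -> Dset w -> 0 <= t -> t <= 1 ->
  Dset (v + t *: (w - v)).
Proof.
move=> Dv Dw t0 t1 i; have := Dv i; have := Dw i; rewrite segmentE !mxE.
nra.
Qed.

End Projection.

Section Scalars.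
Context {R : realType}.

(** Formally 1 / r k.+1 >= 1 / r k + c; the proof avoids dividing by r k,
    which may vanish. *)
Lemma sublinear_rate (r : nat -> R) c : 0 <= c -> (forall k, 0 <= r k) ->
  (forall k, r k.+1 <= r k - c * r k ^+ 2) ->
  forall k, r k <= r 0%N / (1 + k%:R * r 0%N * c).
Proof.
move=> c0 r0 rS.
have den k : 0 < 1 + k%:R * r 0%N * c by rewrite ltr_pwDl// !mulr_ge0.
elim=> [|k IHk]; first by rewrite !mul0r addr0 divr1.
move: IHk; rewrite !ler_pdivlMr// -natr1.
have := rS k; have := r0 k; have := r0 k.+1; have := den k.
move: (r 0%N) (r0 0%N) (r k) (r k.+1) => a a0 x y dk y0 x0 yx.
set d := 1 + k%:R * a * c => xd.
have -> : 1 + (k%:R + 1) * a * c = d + a * c by rewrite /d; ring.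
have yc : y * (1 + c * x) <= x.
  have : y * (1 + c * x) <= (x - c * x ^+ 2) * (1 + c * x).
    by rewrite ler_wpM2r// addr_ge0// mulr_ge0.
  have : 0 <= c ^+ 2 * x ^+ 3 by rewrite mulr_ge0 ?exprn_ge0.
  lra.
have d0 : 0 < d := dk.
have cx0 : 0 < 1 + c * x by rewrite ltr_pwDl// mulr_ge0.
rewrite -(ler_pM2r cx0).
have h1 : y * (1 + c * x) * (d + a * c) <= x * (d + a * c).
  by rewrite ler_wpM2r// addr_ge0 ?mulr_ge0// ltW.
have h2 : a * c * x <= a * c * x by [].
have -> : y * (d + a * c) * (1 + c * x) = y * (1 + c * x) * (d + a * c) by ring.
apply: le_trans h1 _; nra.
Qed.

(** One coordinate of a projected step of length 1/l; r is its contribution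
    to the quadratic lower bound.  Either the step is not clipped and
    r = g^2 / (2 l), or t = - u and r >= l u^2 / 2. *)
Lemma clipped_step_gain (u g l : R) : 0 <= u -> 0 < l ->
  let t := Num.max 0 (u + l^-1 * g) - u in
  let r := g * t - l / 2 * t ^+ 2 in
  Num.max 0 g ^+ 2 <= 2 * l * r /\ - (u * g) <= r + u * Num.sqrt (2 * l * r).
Proof.
move=> u0 l0 /=.
have ll : l * l^-1 = 1 by rewrite divff// gt_eqF.
pose h := l^-1 * g; have gE : g = l * h by rewrite /h mulrA ll mul1r.
rewrite -/h gE; clearbody h; clear gE ll g.
have [uh|uh] := leP 0 (u + h).
  have -> : l * h * (u + h - u) - l / 2 * (u + h - u) ^+ 2 = l / 2 * h ^+ 2 by field.
  have -> : 2 * l * (l / 2 * h ^+ 2) = (l * h) ^+ 2 by field.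
  rewrite sqrtr_sqr; split.
    by case: (leP 0 (l * h)) => _; rewrite ?lexx// expr0n sqr_ge0.
  have := ler_norm (- (l * h)); rewrite normrN => lh.
  have : u * - (l * h) <= u * `|l * h| by rewrite ler_wpM2l.
  have : 0 <= l / 2 * h ^+ 2 by rewrite mulr_ge0 ?sqr_ge0 ?divr_ge0// ltW.
  lra.
have h0 : h < 0 by lra.
set r := l * h * (0 - u) - l / 2 * (0 - u) ^+ 2.
have rE : r = l * u * (- h - u) + l / 2 * u ^+ 2 by rewrite /r; field.
have rge : l / 2 * u ^+ 2 <= r.
  rewrite rE lerDr !mulr_ge0//; first exact: ltW.
  lra.
have r0 : 0 <= r by apply: le_trans rge; rewrite mulr_ge0 ?sqr_ge0 ?divr_ge0// ltW.
split.
  rewrite max_l; last by rewrite pmulr_rle0// ltW.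
  by rewrite expr0n /= !mulr_ge0// ltW.
have : l / 2 * u <= Num.sqrt (2 * l * r).
  rewrite -[leLHS]ger0_norm; last by rewrite mulr_ge0// divr_ge0// ltW.
  rewrite -sqrtr_sqr ler_sqrt; last by rewrite !mulr_ge0// ltW.
  have : l * (l / 2 * u ^+ 2) <= l * r by rewrite ler_pM2l.
  have : 0 <= l ^+ 2 * u ^+ 2 by rewrite mulr_ge0 ?sqr_ge0.
  lra.
move/(ler_wpM2l u0); rewrite {2}/r; lra.
Qed.

End Scalars.

Section ProjectedStep.
Context {R : realType} {m p : nat}.
Implicit Types u z : 'cV[R]_(m + p).

(** Sums [clipped_step_gain] over the nonnegative coordinates; the free
    coordinates make an unclipped step.  The products are recombined by the
    Cauchy-Schwarz inequality. *)
Lemma projected_step_gain u z l : Dset u -> 0 < l ->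
  let v := eproj Dset (u + l^-1 *: z) in
  let r := dot z (v - u) - l / 2 * enorm (v - u) ^+ 2 in
  \sum_i Num.max 0 (usubmx z i 0) ^+ 2 + enorm (dsubmx z) ^+ 2 <= 2 * l * r /\
  - dot u z <= r + enorm u * Num.sqrt (2 * l * r).
Proof.
move=> Du l0 /=; rewrite eprojE; set v := orthant_proj _.
have l0' := ltW l0.
pose a i := usubmx u i 0; pose c i := usubmx z i 0.
pose t i := Num.max 0 (a i + l^-1 * c i) - a i.
pose r i := c i * t i - l / 2 * t i ^+ 2.
pose s := (2 * l)^-1 * enorm (dsubmx z) ^+ 2.
have gain i := clipped_step_gain (c i) (Du i) l0.
have s0 : 0 <= s by rewrite mulr_ge0 ?sqr_ge0// invr_ge0 mulr_ge0.
have r0 i : 0 <= r i.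
  have [h _] := gain i; have l2 : 0 < 2 * l by rewrite mulr_gt0.
  by rewrite -(pmulr_rge0 _ l2); apply: le_trans h; apply: sqr_ge0.
have uE i : usubmx (v - u) i 0 = t i.
  rewrite linearB/= [LHS]mxE [X in _ + X]mxE usubmx_orthant_proj linearD linearZ/=.
  by rewrite [X in Num.max _ X]mxE [X in Num.max _ (_ + X)]mxE.
have dE : dsubmx (v - u) = l^-1 *: dsubmx z.
  by rewrite linearB/= col_mxKd linearD/= addrC addKr linearZ.
have -> : dot z (v - u) - l / 2 * enorm (v - u) ^+ 2 = \sum_i r i + s.
  rewrite enorm_sq !dot_submx dE !dotE -enorm_sq mulrDr opprD addrACA; congr (_ + _).
    rewrite mulr_sumr -sumrB; apply: eq_bigr => i _.
    by rewrite !uE /r expr2.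
  rewrite /s; field; lra.
set S := \sum_i r i; have S0 : 0 <= S by rewrite sumr_ge0.
have sE : enorm (dsubmx z) ^+ 2 = 2 * l * s by rewrite /s; field; lra.
have ssE : enorm (dsubmx z) = Num.sqrt (2 * l * s).
  by rewrite -sE sqrtr_sqr ger0_norm.
split.
  rewrite mulrDr sE lerD2r mulr_sumr; apply: ler_sum => i _.
  by have [] := gain i.
have part1 : - dot (usubmx u) (usubmx z) <=
    S + Num.sqrt (2 * l) * (enorm (usubmx u) * Num.sqrt S).
  apply: (@le_trans _ _ (S + Num.sqrt (2 * l) * \sum_i `|a i| * Num.sqrt (r i))).
    rewrite mulr_sumr -big_split/= -sumrN; apply: ler_sum => i _.
    have [_ h] := gain i; apply: le_trans h _; rewrite lerD2l.
    by rewrite ger0_norm ?Du// sqrtrM ?mulr_ge0// mulrCA.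
  rewrite lerD2l ler_wpM2l ?sqrtr_ge0//.
  apply: le_trans (sum_CauchySchwarz _ _) _.
  have -> : \sum_i a i ^+ 2 = dot (usubmx u) (usubmx u).
    by apply: eq_bigr => i _; rewrite expr2.
  by rewrite (eq_bigr r) => [|i _]; rewrite ?sqr_sqrtr.
have part2 : - dot (dsubmx u) (dsubmx z) <=
    Num.sqrt (2 * l) * (enorm (dsubmx u) * Num.sqrt s).
  rewrite -dotNl; apply: le_trans (dot_le _ _) _.
  by rewrite enormN ssE sqrtrM ?mulr_ge0// mulrCA.
have cs : enorm (usubmx u) * Num.sqrt S + enorm (dsubmx u) * Num.sqrt s
    <= enorm u * Num.sqrt (S + s).
  have S2 := sqr_sqrtr S0; have s2 := sqr_sqrtr s0.
  rewrite -ler_sqr ?nnegrE ?addr_ge0 ?mulr_ge0 ?sqrtr_ge0//.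
  rewrite exprMn (sqr_sqrtr (addr_ge0 S0 s0)) (enorm_sq u) dot_submx -!enorm_sq.
  rewrite -[in leRHS]S2 -[in leRHS]s2.
  have := sqr_ge0 (enorm (usubmx u) * Num.sqrt s - enorm (dsubmx u) * Num.sqrt S).
  lra.
have := ler_wpM2l (sqrtr_ge0 (2 * l)) cs.
rewrite dot_submx [Num.sqrt (2 * l * (S + s))]sqrtrM ?mulr_ge0//.
lra.
Qed.

End ProjectedStep.

Section ConvHull.
Context {R : realType} {n : nat}.

Lemma conv_hull_segment (S : set 'cV[R]_n) x y (t : R) : S x -> S y ->
  0 <= t -> t <= 1 -> conv_hull S (x + t *: (y - x)).
Proof.
move=> Sx Sy t0 t1.
exists 2%N, (fun i : 'I_2 => if i == ord0 then 1 - t else t),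
  (fun i : 'I_2 => if i == ord0 then x else y).
split=> [i||i|].
- by case: ifP => _ //; lra.
- by rewrite !big_ord_recl big_ord0/= addr0 subrK.
- by case: ifP.
- by rewrite !big_ord_recl big_ord0/= addr0 segmentE addrC.
Qed.

Lemma sub_conv_hull (S : set 'cV[R]_n) : S `<=` conv_hull S.
Proof.
move=> x Sx; have := conv_hull_segment Sx Sx (lexx 0) ler01.
by rewrite scale0r addr0.
Qed.

End ConvHull.

(** * The dual function and its supergradient *)

Section DualFunction.
Context {R : realType} {n m p : nat}.
Variable P : problem R n m p.
Local Notation f := (pf P).
Local Notation g := (pg P).
Local Notation A := (pA P).
Local Notation b := (pb P).
Local Notation X := (pX P).
Local Notation D := (@Dset R m p).
Local Notation xbar := (xbar P).
Local Notation gradd := (gradd P).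
Local Notation dualf := (dualf P).

Variables (theta : R) (Lip : 'I_m -> R).
Hypothesis hX : closed X /\ convex_set X.
Hypothesis hf : strongly_convex X f theta.
Hypothesis hf_closed : closed_on X f.
Hypothesis hg : forall i, [/\ convex_function X (g i), 0 < Lip i
                    & lipschitz_over X (g i) (Lip i)].
Hypothesis hg_diff : forall i x, X x -> differentiable (g i) x.
Hypothesis hX0 : X !=set0.

Local Notation gamma := (gamma_const P theta).

Let theta_gt0 : 0 < theta. Proof. by case: hf. Qed.
Let Xcl : closed X. Proof. by case: hX. Qed.
Let Xcvx : convex_set X. Proof. by case: hX. Qed.
Let fcvx : convex_function X f. Proof. by case: hf. Qed.

Definition constraints (x : 'cV[R]_n) : 'cV[R]_(m + p) :=
  col_mx (\col_i g i x) (A *m x + b).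
Local Notation G := constraints.

Definition constraints_lip : R := Num.sqrt (sigma_max A ^+ 2 + \sum_i Lip i ^+ 2).
Local Notation LG := constraints_lip.

Lemma dot_constraints u x :
  dot u (G x) = \sum_i usubmx u i 0 * g i x + dot (dsubmx u) (A *m x + b).
Proof.
rewrite dot_submx col_mxKu col_mxKd; congr (_ + _).
by apply: eq_bigr => i _; rewrite mxE.
Qed.

Lemma LagrE x u : Lagr P x u = f x + dot u (G x).
Proof. by rewrite dot_constraints addrA. Qed.

Lemma constraints_lip_ge0 : 0 <= LG.
Proof. exact: sqrtr_ge0. Qed.

Lemma constraints_lipschitz x y : X x -> X y ->
  enorm (G x - G y) <= LG * enorm (x - y).
Proof.
move=> Xx Xy; rewrite -ler_sqr ?nnegrE ?mulr_ge0 ?constraints_lip_ge0//.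
have LG2 : LG ^+ 2 = sigma_max A ^+ 2 + \sum_i Lip i ^+ 2.
  rewrite sqr_sqrtr// addr_ge0 ?sqr_ge0// sumr_ge0// => i _; exact: sqr_ge0.
rewrite exprMn LG2.
rewrite enorm_sq /G opp_col_mx add_col_mx dot_col_mx mulrDl addrC.
apply: lerD.
  have -> : A *m x + b - (A *m y + b) = A *m (x - y).
    by rewrite mulmxBr opprD addrACA subrr addr0.
  by rewrite -enorm_sq -exprMn ler_sqr ?nnegrE ?mulr_ge0 ?sigma_max_ge0// sigma_max_bound.
rewrite mulr_suml; apply: ler_sum => i _; rewrite !mxE -expr2.
rewrite -[leLHS]real_normK ?num_real// -exprMn.
have [_ L0 gL] := hg i.
by rewrite ler_sqr ?nnegrE ?mulr_ge0 ?gL// ltW.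
Qed.

(** f grows quadratically and the constraints at most linearly, so the
    Lagrangian is coercive for every multiplier. *)
Lemma xbar_minimizer u : is_minimizer (Lagr P ^~ u) X (xbar u).
Proof.
have [x0 Xx0] := hX0; apply: argminP.
have [x [s [Xx fx]]] := strongly_convex_growth Xcl Xcvx hf hf_closed Xx0.
have cl : closed_on X (Lagr P ^~ u).
  have -> : Lagr P ^~ u = fun z => f z + dot u (G z).
    by apply/funext => z; rewrite LagrE.
  apply: closed_onD => //.
  apply: (@lipschitz_enorm_continuous _ _ _ _ (enorm u * LG)) => y z Xy Xz.
  rewrite /= -dotNr -dotDr; apply: (le_trans (norm_dot_le u (G y - G z))).
  by rewrite -mulrA ler_wpM2l// constraints_lipschitz.
apply: (@coercive_minimizer _ _ _ _ x (Lagr P x u) (enorm s + enorm u * LG)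
  (theta / 2) cl Xx); first by rewrite divr_gt0.
move=> y Xy; rewrite !LagrE.
have := fx y Xy; have := norm_dot_le s (y - x).
have := norm_dot_le u (G y - G x); rewrite dotDr dotNr.
have := ler_wpM2l (enorm_ge0 u) (constraints_lipschitz Xy Xx).
rewrite !ler_norml => h1 /andP[h2 _] /andP[h3 _]; nra.
Qed.

Lemma X_xbar u : X (xbar u).
Proof. by case: (xbar_minimizer u). Qed.

Lemma dualf_xbar u : dualf u = f (xbar u) + dot u (gradd u).
Proof.
have [Xx xmin] := xbar_minimizer u; rewrite -(LagrE (xbar u)).
apply/eqP; rewrite eq_le; apply/andP; split.
  apply: ge_inf; last by exists (xbar u).
  by exists (Lagr P (xbar u) u) => _ [y Xy <-]; apply: xmin.
apply: lb_le_inf; first by exists (Lagr P (xbar u) u); exists (xbar u).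
by move=> _ [y Xy <-]; apply: xmin.
Qed.

Lemma dualf_le_Lagr u x : X x -> dualf u <= f x + dot u (G x).
Proof.
move=> Xx; have [_ xmin] := xbar_minimizer u.
by rewrite dualf_xbar -(LagrE (xbar u)) -LagrE; apply: xmin.
Qed.

(** xbar u is a candidate in the minimization that defines dualf v, and the
    Lagrangian is affine in the multiplier. *)
Lemma dualf_supergradient u v : dualf v <= dualf u + dot (gradd u) (v - u).
Proof.
apply: le_trans (dualf_le_Lagr v (X_xbar u)) _.
by rewrite dualf_xbar dotC dotDr dotNr (dotC _ u) -/(gradd u) addrACA subrr addr0.
Qed.

(** Derivative at x in the direction v of the constraints weighted by u. *)
Definition constraints_deriv u x v : R :=
  \sum_i usubmx u i 0 * dot (gradient (g i) x) v + dot (dsubmx u) (A *m v).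
Local Notation dG := constraints_deriv.

Lemma cvg_slope_constraints u x v : X x ->
  slope (fun z => dot u (G z)) x v @ 0^'+ --> dG u x v.
Proof.
move=> Xx.
have -> : (fun z => dot u (G z)) =
    fun z => \sum_i usubmx u i 0 * g i z + dot (dsubmx u) (A *m z + b).
  by apply/funext => z; rewrite dot_constraints.
by apply: cvg_slope_comb => i; apply: hg_diff.
Qed.

(** The condition at a minimizer of the Lagrangian exhibits a subgradient of
    f relative to X at xbar u.  The constraints enter through their
    derivative there, so the multipliers may have any sign. *)
Lemma xbar_first_order u y : X y ->
  theta / 2 * enorm (xbar u - y) ^+ 2
    <= f y - f (xbar u) + dG u (xbar u) (y - xbar u).
Proof.
move=> Xy; set x := xbar u; have Xx : X x := X_xbar u.
have [_ _ fsc] := hf.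
pose s := - (\sum_i usubmx u i 0 *: gradient (g i) x + A^T *m dsubmx u).
have sE v : dot s v = - dG u x v.
  by rewrite dotNl dotDl dot_suml dot_mulmx trmxK.
have -> : dG u x (y - x) = - dot s (y - x) by rewrite sE opprK.
apply: fsc => // z Xz; rewrite sE.
have xmin : is_minimizer (fun z => f z + dot u (G z)) X x.
  have [_ xmin] := xbar_minimizer u; split=> // w Xw.
  by rewrite -!LagrE; apply: xmin.
have := minimizer_slope Xcvx fcvx xmin Xz (cvg_slope_constraints Xx).
lra.
Qed.

Lemma constraints_deriv_le u x y : D u -> X x -> X y ->
  dG u x (y - x) <= dot u (G y - G x).
Proof.
move=> Du Xx Xy; rewrite dotDr dotNr !dot_constraints opprD addrACA -sumrB.
apply: lerD; last first.
  by rewrite -dotNr -dotDr opprD addrACA subrr addr0 mulmxBr.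
apply: ler_sum => i _; rewrite -mulrBr ler_wpM2l ?Du//.
by have [gc _ _] := hg i; apply: (gradient_inequality Xcvx gc) => //; apply: hg_diff.
Qed.

Lemma Lagr_growth u y : D u -> X y ->
  dualf u + theta / 2 * enorm (xbar u - y) ^+ 2 <= f y + dot u (G y).
Proof.
move=> Du Xy; have := xbar_first_order u Xy.
have := constraints_deriv_le Du (X_xbar u) Xy.
rewrite dualf_xbar dotDr dotNr -/(gradd u); lra.
Qed.

(** Cauchy-Schwarz over m + 1 terms: the m gradients and the block A.  This
    is the origin of the factor sqrt (m + 1) in gamma. *)
Lemma constraints_deriv_bound w u v :
  dG w (xbar u) v <=
    Num.sqrt m.+1%:R * enorm w *
    Num.max (sigma_max A)
      (\big[Num.max/0]_(i < m) enorm (gradient (g i) (xbar u))) * enorm v.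
Proof.
set M := Num.max _ _; set x := xbar u.
have sM : sigma_max A <= M by rewrite le_max lexx.
have gM i : enorm (gradient (g i) x) <= M.
  by rewrite le_max; apply/orP; right; apply: (le_bigmax _ (fun i => enorm (gradient (g i) x))).
have M0 : 0 <= M by apply: le_trans sM; apply: sigma_max_ge0.
pose a (i : 'I_m) := usubmx w i 0; pose c := enorm (dsubmx w).
apply: (@le_trans _ _ ((\sum_i `|a i| + c) * (M * enorm v))).
  rewrite mulrDl; apply: lerD.
    rewrite mulr_suml; apply: ler_sum => i _; apply: le_trans (ler_norm _) _.
    rewrite normrM ler_wpM2l//; apply: le_trans (norm_dot_le _ _) _.
    by rewrite ler_wpM2r.
  apply: le_trans (dot_le _ _) _; rewrite ler_wpM2l//.
  by apply: le_trans (sigma_max_bound _ _) _; rewrite ler_wpM2r.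
rewrite -[leRHS]mulrA ler_wpM2r ?mulr_ge0//.
(* the m + 1 coefficients: those of the gradients, and the size of the block
   of w that multiplies A *)
pose h (i : 'I_m.+1) := if unlift ord0 i is Some j then a j else c.
have := sum_CauchySchwarz h (fun=> 1).
rewrite !big_ord_recl /h unlift_none.
under eq_bigr do rewrite liftK mulr1.
under [X in Num.sqrt (_ + X) * _]eq_bigr do rewrite liftK.
rewrite (ger0_norm (enorm_ge0 _)) mulr1 addrC => /le_trans; apply.
rewrite mulrC ler_pM ?sqrtr_ge0//.
  by rewrite ler_sqrt// expr1n sumr_const card_ord -mulrS.
have -> : \sum_i a i ^+ 2 = dot (usubmx w) (usubmx w).
  by apply: eq_bigr => i _; rewrite expr2.
by rewrite [c ^+ 2]enorm_sq addrC -dot_submx.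
Qed.

Lemma gamma_ge0 u : 0 <= gamma u.
Proof.
by rewrite mulr_ge0 ?divr_ge0 ?sqrtr_ge0 ?(ltW theta_gt0)// le_max sigma_max_ge0.
Qed.

(** Add the growth estimates at u and at v.  Convexity of the constraints
    weighted by v >= 0 replaces the derivative at xbar v by the one at
    xbar u, after which only u - v and gradients at xbar u are left: hence
    the asymmetric constant gamma u. *)
Lemma xbar_lipschitz u v : D v ->
  enorm (xbar u - xbar v) <= gamma u * enorm (u - v).
Proof.
move=> Dv; set x := xbar u; set y := xbar v.
have Xx : X x := X_xbar u; have Xy : X y := X_xbar v.
have h1 := xbar_first_order u Xy; have h2 := xbar_first_order v Xx.
have h3 := constraints_deriv_le Dv Xx Xy; have h4 := constraints_deriv_le Dv Xy Xx.
have h5 := constraints_deriv_bound (u - v) u (y - x).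
have dGB : dG (u - v) x (y - x) = dG u x (y - x) - dG v x (y - x).
  have ue : usubmx (u - v) = usubmx u - usubmx v by rewrite linearB.
  have de : dsubmx (u - v) = dsubmx u - dsubmx v by rewrite linearB.
  rewrite /dG ue de dotDl dotNl opprD addrACA; congr (_ + _).
  by rewrite -sumrB; apply: eq_bigr => i _; rewrite !mxE mulrBl.
move: h1 h2 h3 h4 h5; rewrite -/x -/y dGB (enormB y x) !dotDr !dotNr.
set r := enorm (x - y); set e := enorm (u - v).
set M := Num.max _ _ => h1 h2 h3 h4 h5.
have : theta * r ^+ 2 <= Num.sqrt m.+1%:R * e * M * r by lra.
have r0 : 0 <= r := enorm_ge0 _.
have [->|rneq0] := eqVneq r 0; first by move=> _; exact: mulr_ge0 (gamma_ge0 u) (enorm_ge0 _).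
have rgt0 : 0 < r by rewrite lt_def rneq0.
rewrite expr2 mulrA ler_pM2r// => h.
rewrite /gamma_const -/M.
have -> : Num.sqrt m.+1%:R / theta * M * e = Num.sqrt m.+1%:R * e * M / theta.
  by ring.
by rewrite ler_pdivlMr// mulrC.
Qed.

Lemma gradd_lipschitz u v : D v ->
  enorm (gradd u - gradd v) <= gamma u * LG * enorm (u - v).
Proof.
move=> Dv; apply: le_trans (constraints_lipschitz (X_xbar u) (X_xbar v)) _.
by rewrite -mulrA mulrCA ler_wpM2l ?constraints_lip_ge0 ?xbar_lipschitz.
Qed.

(** * Optimal multipliers *)

Section Optimum.
Variable us : 'cV[R]_(m + p).
Hypothesis hus : Dstar P us.
Let Dus : D us. Proof. by case: hus. Qed.

(** Along the segment from us to w, concavity and maximality make the slope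
    of the dual nonpositive at interior points; the Lipschitz estimate
    around us carries the sign to us itself. *)
Lemma Dstar_variational w : D w -> dot (gradd us) (w - us) <= 0.
Proof.
move=> Dw; set v := w - us; pose c := gamma us * LG * enorm v ^+ 2.
have c0 : 0 <= c.
  exact: mulr_ge0 (mulr_ge0 (gamma_ge0 us) constraints_lip_ge0) (sqr_ge0 _).
rewrite leNgt; apply/negP; set a := dot _ _ => a0.
have step t : 0 < t -> t <= 1 -> a <= t * c.
  move=> t0 t1; set z := us + t *: v.
  have Dz : D z by apply: Dset_segment => //; apply: ltW.
  have := dualf_supergradient z us; have := hus.2 z Dz.
  have -> : us - z = - t *: v by rewrite /z opprD addrA subrr add0r scaleNr.
  rewrite dotZr => h1 h2; have h3 : dot (gradd z) v <= 0 by nra.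
  have := gradd_lipschitz us Dz.
  have -> : us - z = - t *: v by rewrite /z opprD addrA subrr add0r scaleNr.
  rewrite enormZ normrN (ger0_norm (ltW t0)) => h4.
  have := dot_le (gradd us - gradd z) v; rewrite dotDl dotNl -/a.
  have := ler_wpM2r (enorm_ge0 v) h4; rewrite /c; lra.
(* t * c < a for this t *)
pose t := a / (a + c).
have ac : 0 < a + c by lra.
have t0 : 0 < t by rewrite divr_gt0.
have tac : t * (a + c) = a by rewrite divfK// gt_eqF.
have t1 : t <= 1 by rewrite ler_pdivrMr//; lra.
have := step _ t0 t1; nra.
Qed.

(** The orthant is a cone: test the variational inequality at us + w. *)
Lemma Dstar_supporting w : D w -> dot (gradd us) w <= 0.
Proof.
move=> Dw; have := @Dstar_variational (w + us); rewrite addrK; apply.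
by move=> i; rewrite !mxE addr_ge0//; [have := Dw i|have := Dus i]; rewrite !mxE.
Qed.

Lemma Dstar_complementary : dot (gradd us) us = 0.
Proof.
apply/eqP; rewrite eq_le Dstar_supporting//= -oppr_le0 -dotNr -[- us]sub0r.
by apply: Dstar_variational => i; rewrite !mxE.
Qed.

(** Test [Dstar_supporting] on the unit vectors for the inequalities, and on
    the residual itself for the equations. *)
Lemma xbar_Dstar_feasible : feasible P (xbar us).
Proof.
split; first exact: X_xbar.
  move=> i; have Di : D (col_mx (delta_mx i 0) 0).
    by move=> j; rewrite col_mxKu mxE ler0n.
  have := Dstar_supporting Di.
  rewrite dot_col_mx dot0r addr0 /dot (bigD1 i)//= !mxE !eqxx mulr1 big1 ?addr0//.
  by move=> j /negPf ji; rewrite !mxE ji mulr0.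
apply: dot_eq0.
have := @Dstar_supporting (col_mx 0 (A *m xbar us + b)).
rewrite dot_col_mx dot0r add0r => h; apply/eqP; rewrite eq_le dot_ge0 h//.
by move=> i; rewrite col_mxKu mxE.
Qed.

Lemma f_xbar_Dstar : f (xbar us) = dualf us.
Proof. by rewrite dualf_xbar dotC Dstar_complementary addr0. Qed.

Lemma feasible_growth x : feasible P x ->
  f (xbar us) + theta / 2 * enorm (xbar us - x) ^+ 2 <= f x.
Proof.
move=> [Xx gx Ax]; have := Lagr_growth Dus Xx.
rewrite f_xbar_Dstar dot_constraints Ax dot0r addr0 => /le_trans; apply.
by rewrite gerDl; apply: sumr_le0 => i _; rewrite mulr_ge0_le0.
Qed.

(** The Lagrangian at us is below f on the feasible set and equals f at
    xbar us, with quadratic growth; this also gives uniqueness. *)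
Lemma xstarE : xstar P = xbar us.
Proof.
have [Fx xmin] : is_minimizer f (feasible P) (xstar P).
  apply: argminP; exists (xbar us); split; first exact: xbar_Dstar_feasible.
  move=> x /feasible_growth; apply: le_trans.
  by rewrite lerDl mulr_ge0 ?sqr_ge0// divr_ge0// ltW.
have := feasible_growth Fx; have := xmin _ xbar_Dstar_feasible => h1 h2.
apply/esym/eqP; rewrite -subr_eq0; apply/eqP/enorm_eq0/eqP.
rewrite -sqrf_eq0 eq_le sqr_ge0 andbT.
have th2 : 0 < theta / 2 by rewrite divr_gt0.
by rewrite -(pmulr_rle0 _ th2); lra.
Qed.

Lemma fstarE : fstar P = dualf us.
Proof. by rewrite /fstar xstarE f_xbar_Dstar. Qed.

Lemma dstarE : dstar P = dualf us.
Proof.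
apply/eqP; rewrite eq_le; apply/andP; split.
  apply: ge_sup; first by exists (dualf us), us.
  by move=> _ [v Dv <-]; apply: hus.2.
apply: ub_le_sup; last by exists us.
by exists (dualf us) => _ [v Dv <-]; apply: hus.2.
Qed.

Lemma xbar_xstar_dist u : D u ->
  theta / 2 * enorm (xbar u - xstar P) ^+ 2 <= dualf us - dualf u.
Proof.
move=> Du; rewrite xstarE.
have [Xx gx Ax] := xbar_Dstar_feasible.
have := Lagr_growth Du Xx.
rewrite dot_constraints Ax dot0r addr0 f_xbar_Dstar => h.
have : \sum_i usubmx u i 0 * g i (xbar us) <= 0.
  by apply: sumr_le0 => i _; rewrite mulr_ge0_le0.
lra.
Qed.

(** A nonnegative multiplier only sees the positive parts of the inequality
    constraints. *)
Lemma dot_gradd_infeas u w : D w ->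
  dot w (gradd u) <= enorm w * infeas P (xbar u).
Proof.
move=> Dw; pose g' := col_mx (\col_i Num.max 0 (g i (xbar u))) (A *m xbar u + b).
have -> : infeas P (xbar u) = enorm g'.
  rewrite /infeas /enorm dot_col_mx sqr_sqrtr ?dot_ge0// addrC; congr (Num.sqrt (_ + _)).
  by apply: eq_bigr => i _; rewrite mxE expr2.
apply: le_trans (dot_le _ _); rewrite !dot_submx !col_mxKu !col_mxKd lerD2r.
apply: ler_sum => i _; rewrite ler_wpM2l ?Dw// !mxE.
by rewrite le_max lexx orbT.
Qed.

Lemma f_xbar_ge u : dualf us - enorm us * infeas P (xbar u) <= f (xbar u).
Proof.
have := dualf_le_Lagr us (X_xbar u).
by have := dot_gradd_infeas u Dus; rewrite -/(gradd u); lra.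
Qed.

Lemma gradd_lipschitz_segment u v l : D u ->
  (forall t : R, 0 <= t -> t <= 1 -> gamma (u + t *: v) * LG <= l) ->
  forall t : R, 0 <= t -> t <= 1 ->
    enorm (gradd (u + t *: v) - gradd u) <= l * (t * enorm v).
Proof.
move=> Du hl t t0 t1; apply: le_trans (gradd_lipschitz _ Du) _.
have -> : u + t *: v - u = t *: v by rewrite addrC addKr.
by rewrite enormZ ger0_norm// ler_wpM2r ?mulr_ge0// hl.
Qed.

Lemma dualf_descent u w l : D u ->
  (forall t : R, 0 <= t -> t <= 1 -> gamma (u + t *: (w - u)) * LG <= l) ->
  dualf u + dot (gradd u) (w - u) - l / 2 * enorm (w - u) ^+ 2 <= dualf w.
Proof.
move=> Du hl; apply: (supergradient_descent (s := gradd)).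
  exact: dualf_supergradient.
exact: gradd_lipschitz_segment.
Qed.

(** * One projected gradient step *)

Section Step.
Variables (u : 'cV[R]_(m + p)) (alpha : R).
Hypotheses (Du : D u) (alpha0 : 0 < alpha).
Let v := eproj D (u + alpha *: gradd u).

(** The obtuse angle inequality at the projection, tested at u, bounds the
    linear gain below by |v - u|^2 / alpha. *)
Lemma step_progress l :
  (forall t : R, 0 <= t -> t <= 1 -> gamma (u + t *: (v - u)) * LG <= l) ->
  dualf u + (alpha^-1 - l / 2) * enorm (v - u) ^+ 2 <= dualf v.
Proof.
move=> /(dualf_descent Du); apply: le_trans.
have := eproj_obtuse (u + alpha *: gradd u) Du; rewrite -/v.
have -> : u - v = - (v - u) by rewrite opprB.
have -> : u + alpha *: gradd u - v = alpha *: gradd u - (v - u).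
  by rewrite opprB addrA addrAC addrC addrA.
rewrite dotNr dotDl dotNl dotZl enorm_sq => h.
have : alpha^-1 * dot (v - u) (v - u) <= dot (gradd u) (v - u).
  by rewrite ler_pdivrMl//; lra.
lra.
Qed.

(** Split us - u at v: the obtuse angle inequality tested at us handles
    us - v, and the size of the dual gradient handles v - u. *)
Lemma step_gap K M : enorm (gradd u) <= K -> enorm (us - v) <= M ->
  dualf us - dualf u <= (K + M / alpha) * enorm (v - u).
Proof.
move=> uK vM.
have := eproj_obtuse (u + alpha *: gradd u) Dus; rewrite -/v => h.
have h1 := dualf_supergradient u us.
have h2 := dot_le (gradd u) (v - u).
have h3 := ler_wpM2r (enorm_ge0 (v - u)) uK.
have h4 := dot_le (v - u) (us - v).
have h5 := ler_wpM2l (enorm_ge0 (v - u)) vM.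
have h6 : alpha * dot (gradd u) (us - v) <= dot (v - u) (us - v).
  have e : u + alpha *: gradd u - v = alpha *: gradd u - (v - u).
    by rewrite opprB addrA addrAC addrC addrA.
  by rewrite e dotDl dotNl dotZl in h; lra.
have h7 : dot (gradd u) (us - v) <= M / alpha * enorm (v - u).
  rewrite mulrAC ler_pdivlMr//; lra.
have h8 : dot (gradd u) (us - u) = dot (gradd u) (us - v) + dot (gradd u) (v - u).
  by rewrite -dotDr subrKA.
lra.
Qed.

(** us is a fixed point of the step.  The obtuse angle inequality at v and
    the variational inequality at us give |v - us| <= |(u - us) + alpha e|,
    where e is the difference of dual gradients, and cocoercivity removes
    the second term. *)
Lemma step_nonexpansive :
  alpha * enorm (gradd u - gradd us) ^+ 2
    <= - (2 * dot (gradd u - gradd us) (u - us)) ->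
  enorm (v - us) <= enorm (u - us).
Proof.
move=> coco; set e := gradd u - gradd us in coco.
have Dv : D v := eproj_D _.
have h1 := eproj_obtuse (u + alpha *: gradd u) Dus; rewrite -/v in h1.
have h2 := Dstar_variational Dv.
have h3 : enorm (u - us + alpha *: e) <= enorm (u - us).
  rewrite -ler_sqr ?nnegrE// !enorm_sq; set a := u - us in coco *.
  move: (a) (e) coco => x y; rewrite enorm_sq => coco.
  have := ler_wpM2l (ltW alpha0) coco.
  rewrite !dotE (dotC x y); lra.
have h4 : enorm (v - us) ^+ 2 <= dot (u - us + alpha *: e) (v - us).
  rewrite enorm_sq.
  have -> : u - us + alpha *: e =
      (u + alpha *: gradd u - v) + (v - us) - alpha *: gradd us.
    by rewrite subrKA /e scalerBr [LHS]addrA (addrAC u).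
  have e1 : us - v = - (v - us) by rewrite opprB.
  move: h1; rewrite e1 dotNr => h1.
  rewrite [in leRHS]dotDl [in leRHS]dotDl dotNl dotZl.
  have := ler_wpM2l (ltW alpha0) h2; rewrite mulr0; lra.
have [vus|vus] := eqVneq (enorm (v - us)) 0; first by rewrite vus enorm_ge0.
have v0 : 0 < enorm (v - us) by rewrite lt_def vus enorm_ge0.
apply: le_trans h3; rewrite -(ler_pM2r v0) -expr2.
exact: le_trans h4 (dot_le _ _).
Qed.

End Step.

Section TrialStep.
Variables (u : 'cV[R]_(m + p)) (l : R).
Hypotheses (Du : D u) (l0 : 0 < l).
Let v := eproj D (u + l^-1 *: gradd u).
Hypothesis hl :
  forall t : R, 0 <= t -> t <= 1 -> gamma (u + t *: (v - u)) * LG <= l.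

Let gain_le : dot (gradd u) (v - u) - l / 2 * enorm (v - u) ^+ 2 <= dualf us - dualf u.
Proof.
have := dualf_descent Du hl; have := hus.2 v (eproj_D _); lra.
Qed.

(** The gain of the trial step from u to v is at most the dual gap at u. *)
Lemma infeas_sqr_le : infeas P (xbar u) ^+ 2 <= 2 * l * (dualf us - dualf u).
Proof.
have [h _] := projected_step_gain (gradd u) Du l0.
apply: le_trans (ler_wpM2l _ gain_le); last by rewrite mulr_ge0// ltW.
apply: le_trans h; rewrite /infeas sqr_sqrtr; last first.
  by rewrite addr_ge0 ?sqr_ge0 ?sumr_ge0// => i _; rewrite sqr_ge0.
rewrite addrC col_mxKd; apply: lerD => //.
by apply: ler_sum => i _; rewrite col_mxKu mxE.
Qed.

(** f (xbar u) = dualf u - <u, gradd u>, and the gain of the trial step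
    controls the product. *)
Lemma f_xbar_le : f (xbar u) <=
  dualf us + enorm u * Num.sqrt (2 * l * (dualf us - dualf u)).
Proof.
have [_ h] := projected_step_gain (gradd u) Du l0.
have : enorm u * Num.sqrt (2 * l * (dot (gradd u) (v - u) - l / 2 * enorm (v - u) ^+ 2))
    <= enorm u * Num.sqrt (2 * l * (dualf us - dualf u)).
  by rewrite ler_wpM2l// ler_wsqrtr// ler_wpM2l ?gain_le// mulr_ge0// ltW.
have := gain_le; have := dualf_xbar u; move: h; rewrite -/v; lra.
Qed.

End TrialStep.

(** * The iterates and the rate in the dual *)

Section Iterates.
Variables (ut u0 : 'cV[R]_(m + p)).
Hypothesis hut_neg : forall i, usubmx ut i 0 < 0.
Hypothesis Du0 : D u0.

Let r0 := enorm (u0 - us).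
Let D0 : set 'cV[R]_(m + p) := [set v | D v /\ enorm (v - us) <= enorm (u0 - us)].
Let etaD := eta_const P theta ut D0.
Let PsiD := Psi P theta ut D0.

Lemma u0_in_ball : D0 u0. Proof. by []. Qed.

Lemma ustar_in_ball : D0 us.
Proof. by split=> //; rewrite subrr enorm0 enorm_ge0. Qed.

Lemma ball_segment u w (t : R) : D0 u -> D0 w -> 0 <= t -> t <= 1 ->
  D0 (u + t *: (w - u)).
Proof.
move=> [Du uu] [Dw wu] t0 t1; split; first exact: Dset_segment.
have -> : u + t *: (w - u) - us = (1 - t) *: (u - us) + t *: (w - us).
  by rewrite segmentE !scalerBr addrACA (addrC (t *: w)) -opprD -scalerDl subrK scale1r.
apply: le_trans (enormD _ _) _; rewrite !enormZ !ger0_norm ?subr_ge0//.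
have := ler_wpM2l t0 wu; have t1' : 0 <= 1 - t by lra.
have := ler_wpM2l t1' uu; lra.
Qed.

Lemma gradd_bounded v : D0 v ->
  enorm (gradd v) <= enorm (gradd us) + gamma us * LG * r0.
Proof.
move=> [Dv vu]; have := enorm_distD (gradd us) (gradd v) 0; rewrite !subr0 => h.
apply: le_trans h _; rewrite addrC lerD2l enormB.
apply: le_trans (gradd_lipschitz us Dv) _.
rewrite enormB; apply: ler_wpM2l vu.
exact: mulr_ge0 (gamma_ge0 us) constraints_lip_ge0.
Qed.

(** If eta vanishes then so do A and all the differences of inequality
    constraints over the ball.  The supremum in econst is only meaningful
    because the dual gradient is bounded there. *)
Lemma eta_eq0_gradd u v : D0 u -> D0 v -> etaD <= 0 -> gradd u = gradd v.
Proof.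
move=> Du Dv; rewrite /etaD /eta_const.
case: ifPn => [e0 /(lt_le_trans e0)|]; first by rewrite ltxx.
rewrite -leNgt => e0 s0.
have A0 (x : 'cV[R]_n) : A *m x = 0.
  apply: enorm_eq0; apply/eqP; rewrite eq_le enorm_ge0 andbT.
  apply: le_trans (sigma_max_bound _ _) _.
  suff -> : sigma_max A = 0 by rewrite mul0r.
  apply/eqP; rewrite -sqrf_eq0 eq_le sqr_ge0 andbT.
  by move: s0; rewrite ler_pdivrMr// mul0r.
rewrite -[LHS]vsubmxK -[RHS]vsubmxK; congr col_mx; last first.
  by rewrite !col_mxKd !A0.
apply/colP => i; apply/eqP; rewrite -subr_eq0 -normr_eq0.
pose F (u v : 'cV[R]_(m + p)) := \big[Num.max/0]_(i < m)
  (- `|usubmx (gradd u) i 0 - usubmx (gradd v) i 0| / usubmx ut i 0).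
pose K : R := enorm (gradd us) + gamma us * LG * r0.
have Fub : has_ubound [set F u v | u in D0 & v in D0].
  exists (\sum_i (K + K) * (- usubmx ut i 0)^-1) => _ [u' Du' [v' Dv' <-]].
  have K0 : 0 <= K by apply: le_trans (gradd_bounded Du).
  have term0 (j : 'I_m) : 0 <= (K + K) * (- usubmx ut j 0)^-1.
    by apply: mulr_ge0; [exact: addr_ge0|rewrite invr_ge0 oppr_ge0 ltW].
  apply: bigmax_le; first by apply: sumr_ge0.
  move=> j _; rewrite (bigD1 j)//=; apply: ler_wpDr; first by apply: sumr_ge0.
  rewrite mulNr -mulrN -invrN ler_wpM2r ?invr_ge0 ?oppr_ge0 ?(ltW (hut_neg j))//.
  have := gradd_bounded Du'; have := gradd_bounded Dv'; rewrite -/K => h1 h2.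
  have := norm_coord_le (gradd u') (lshift p j).
  have := norm_coord_le (gradd v') (lshift p j).
  have := ler_normB (usubmx (gradd u') j 0) (usubmx (gradd v') j 0).
  by rewrite ![usubmx _ _ _]mxE; lra.
have : F u v <= econst P ut D0 by apply: ub_le_sup Fub _ _; exists u => //; exists v.
move=> /le_trans/(_ e0) Fuv.
have : - `|usubmx (gradd u) i 0 - usubmx (gradd v) i 0| / usubmx ut i 0 <= 0.
  by apply: le_trans Fuv; apply: (le_bigmax _ (fun i => - `|usubmx (gradd u) i 0 - usubmx (gradd v) i 0| / usubmx ut i 0)).
rewrite mulNr -mulrN -invrN ler_pdivrMr ?oppr_gt0// mul0r => h.
by rewrite eq_le h normr_ge0.
Qed.

Lemma Psi_generator u v (beta : R) : 0 < etaD -> D0 u -> D0 v ->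
  0 <= beta -> beta <= etaD^-1 -> PsiD (u + beta *: (gradd u - gradd v)).
Proof.
move=> e0 Du Dv b0 b1; rewrite /PsiD /Psi -/etaD e0; apply: sub_conv_hull.
by exists u, v, beta; split=> //; apply/andP.
Qed.

Lemma sub_Psi : D0 `<=` PsiD.
Proof.
move=> u Du; have [e0|e0] := ltP 0 etaD.
  have := @Psi_generator u u 0 e0 Du Du (lexx 0); rewrite scale0r addr0; apply.
  by rewrite invr_ge0 ltW.
by rewrite /PsiD /Psi -/etaD ltNge e0.
Qed.

Section StepSize.
Variables (l alpha : R).
Hypothesis hl : forall z, PsiD z -> gamma z * LG <= l.
Hypotheses (l_gt0 : 0 < l) (alpha0 : 0 < alpha).
Hypothesis halpha : if etaD < l then alpha < 2 / l
                    else alpha < 4 * (etaD^-1 - l / (2 * etaD ^+ 2)).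

(** [supergradient_cocoercive] with step 1/l when 1/l <= 1/eta, and with the
    longest step 1/eta of Psi otherwise; alpha is at most twice the resulting
    cocoercivity modulus. *)
Lemma gradd_cocoercive u v : D0 u -> D0 v ->
  alpha * enorm (gradd u - gradd v) ^+ 2
    <= - (2 * dot (gradd u - gradd v) (u - v)).
Proof.
move=> Du Dv; have [e0|e0] := ltP 0 etaD; last first.
  by rewrite (eta_eq0_gradd Du Dv e0) subrr enorm0 dot0l expr0n/= !mulr0 oppr0.
have coco beta : 0 <= beta -> beta <= etaD^-1 ->
    (2 * beta - l * beta ^+ 2) * enorm (gradd u - gradd v) ^+ 2
    <= - dot (gradd u - gradd v) (u - v).
  move=> b0 b1.
  have slip x y : D0 x -> D0 y -> forall t : R, 0 <= t -> t <= 1 ->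
      gamma (x + t *: (beta *: (gradd x - gradd y))) * LG <= l.
    move=> Dx Dy t t0 t1; rewrite scalerA; apply/hl/Psi_generator => //.
      exact: mulr_ge0.
    by apply: le_trans b1; rewrite ler_piMl.
  apply: (@supergradient_cocoercive _ _ dualf gradd) => //.
  - exact: dualf_supergradient.
  - by apply: gradd_lipschitz_segment; [case: Du|apply: slip].
  - by apply: gradd_lipschitz_segment; [case: Dv|apply: slip].
have E0 := sqr_ge0 (enorm (gradd u - gradd v)).
move: halpha; case: ifPn => [el|]; last rewrite -leNgt => le; move=> al.
  have b1 : l^-1 <= etaD^-1 by rewrite lef_pV2 ?posrE// ltW.
  have := coco _ (ltW (etrans (invr_gt0 _) l_gt0)) b1.
  have -> : 2 * l^-1 - l * l^-1 ^+ 2 = l^-1 by field; rewrite gt_eqF.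
  have := ler_wpM2r E0 (ltW al); lra.
have := coco _ (ltW (etrans (invr_gt0 _) e0)) (lexx _).
have := ler_wpM2r E0 (ltW al).
have -> : 4 * (etaD^-1 - l / (2 * etaD ^+ 2)) = 2 * (2 * etaD^-1 - l * etaD^-1 ^+ 2).
  by field; rewrite gt_eqF.
lra.
Qed.

(** In the second case completing the square shows that the bound on alpha
    never exceeds 2/l. *)
Lemma step_size_small : 0 < alpha^-1 - l / 2.
Proof.
suff al : alpha < 2 / l.
  by rewrite subr_gt0 -ltf_pV2 ?posrE ?invr_gt0 ?divr_gt0// invrK invf_div.
move: halpha; case: ifPn => [//|]; rewrite -leNgt => le al.
have e0 : 0 < etaD by apply: lt_le_trans le.
apply: lt_le_trans al _.
have -> : 4 * (etaD^-1 - l / (2 * etaD ^+ 2)) = 2 / l - 2 / l * (l / etaD - 1) ^+ 2.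
  by field; rewrite !gt_eqF.
by rewrite gerBl mulr_ge0 ?sqr_ge0// divr_ge0// ltW.
Qed.

Variable u : nat -> 'cV[R]_(m + p).
Hypothesis hu_init : u 0%N = u0.
Hypothesis hu_step : forall k, u k.+1 = eproj D (u k + alpha *: gradd (u k)).

Lemma iterates_ball k : D0 (u k).
Proof.
elim: k => [|k IHk]; first by rewrite hu_init.
rewrite hu_step; split; first exact: eproj_D.
apply: le_trans IHk.2; apply: step_nonexpansive => //.
exact: gradd_cocoercive ustar_in_ball.
Qed.

Lemma has_ubound_gradd : has_ubound [set enorm (gradd v) | v in D0].
Proof.
exists (enorm (gradd us) + gamma us * LG * r0) => _ [v Dv <-].
exact: gradd_bounded.
Qed.

Let K := sup [set enorm (gradd v) | v in D0].
Let rho := (K + r0 / alpha) ^+ 2.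

Lemma rho_gt0 : dualf u0 < dualf us -> 0 < rho.
Proof.
move=> u0us; have K0 : 0 <= K.
  apply: le_trans (enorm_ge0 (gradd u0)) _.
  by apply: ub_le_sup; [exact: has_ubound_gradd|exists u0].
have r0_gt0 : 0 < r0.
  rewrite enorm_gt0// subr_eq0; apply/eqP => e.
  by move: u0us; rewrite e ltxx.
by rewrite exprn_gt0// ltr_wpDl// divr_gt0.
Qed.

(** Progress at least delta e^2 and gap at most sqrt(rho) e, where e is the
    length of the step. *)
Lemma dual_rate : dualf u0 < dualf us -> forall k,
  dualf us - dualf (u k) <= (dualf us - dualf u0) /
    (1 + k%:R * (dualf us - dualf u0) * (alpha^-1 - l / 2) * rho^-1).
Proof.
move=> u0us k; have rho0 := rho_gt0 u0us.
pose c := (alpha^-1 - l / 2) * rho^-1.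
have c0 : 0 <= c by rewrite mulr_ge0 ?invr_ge0 ?ltW// step_size_small.
have := @sublinear_rate _ (fun k => dualf us - dualf (u k)) c c0 _ _ k.
rewrite /= hu_init mulrA; apply=> [j|j].
  by rewrite subr_ge0; apply: hus.2; case: (iterates_ball j).
have Dj := iterates_ball j; have Dj1 := iterates_ball j.+1.
have seg (t : R) : 0 <= t -> t <= 1 ->
    gamma (u j + t *: (eproj D (u j + alpha *: gradd (u j)) - u j)) * LG <= l.
  move=> t0 t1; apply/hl/sub_Psi; apply: ball_segment => //.
  by rewrite -hu_step.
have := step_progress Dj.1 alpha0 seg; rewrite -hu_step.
have gK : enorm (gradd (u j)) <= K.
  by apply: ub_le_sup; [exact: has_ubound_gradd|exists (u j)].
have gM : enorm (us - eproj D (u j + alpha *: gradd (u j))) <= r0.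
  by rewrite -hu_step enormB; case: Dj1.
have := step_gap alpha0 gK gM; rewrite -hu_step.
set x := dualf us - dualf (u j); set e := enorm (u j.+1 - u j) => gap prog.
have x0 : 0 <= x by rewrite subr_ge0; apply: hus.2; case: Dj.
have : c * x ^+ 2 <= (alpha^-1 - l / 2) * e ^+ 2.
  rewrite /c -mulrA ler_wpM2l ?(ltW step_size_small)//.
  rewrite ler_pdivrMl// /rho -exprMn ler_sqr ?nnegrE//.
  exact: le_trans gap.
rewrite /x; lra.
Qed.

End StepSize.
End Iterates.

(** * The rates in the primal *)

Section Conclusion.
Variables (ut u0 : 'cV[R]_(m + p)) (u : nat -> 'cV[R]_(m + p)) (alpha : R).
Hypothesis hut_neg : forall i, usubmx ut i 0 < 0.
Hypothesis hgamma : forall w, D w -> 0 < gamma w.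
Hypothesis Du0 : D u0.
Hypothesis hu_init : u 0%N = u0.
Hypothesis hu_step : forall k, u k.+1 = eproj D (u k + alpha *: gradd (u k)).

Let D0 : set 'cV[R]_(m + p) := [set v | D v /\ enorm (v - us) <= enorm (u0 - us)].
Let R0 := dstar P - dualf u0.
Let LPsi := Lconst P theta Lip (Psi P theta ut D0).
Let LPhi := Lconst P theta Lip (Phi P theta Lip D0).
Let etaD := eta_const P theta ut D0.

(** gamma us > 0 excludes a problem without inequality constraints whose
    matrix A vanishes. *)
Lemma constraints_lip_gt0 : 0 < LG.
Proof.
rewrite lt_def constraints_lip_ge0 andbT; apply/eqP => LG0.
have S0 : 0 <= \sum_i Lip i ^+ 2 by apply: sumr_ge0 => i _; apply: sqr_ge0.
have s0 := sqr_ge0 (sigma_max A).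
have e0 : sigma_max A ^+ 2 + \sum_i Lip i ^+ 2 = 0.
  by rewrite -[LHS]sqr_sqrtr ?addr_ge0// -/LG LG0 expr0n.
have sig0 : sigma_max A = 0 by apply/eqP; rewrite -sqrf_eq0; apply/eqP; lra.
have noi (i : 'I_m) : False.
  have [_ Li _] := hg i; have := exprn_gt0 2 Li.
  have : \sum_i Lip i ^+ 2 = 0 by lra.
  move/eqP; rewrite psumr_eq0 => [/allP/(_ i (mem_index_enum i))/eqP->|j _].
    by rewrite ltxx.
  exact: sqr_ge0.
have := hgamma Dus; rewrite /gamma_const sig0.
rewrite (_ : Num.max _ _ = 0) ?mulr0 ?ltxx//.
by apply/max_idPl; apply: bigmax_le => // i; case: (noi i).
Qed.

Lemma Lconst_ub S z : S z -> ((gamma z * LG)%:E <= Lconst P theta Lip S)%E.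
Proof. by move=> Sz; apply: ereal_sup_ubound; exists z. Qed.

Lemma Lconst_cases (S : set 'cV[R]_(m + p)) : S u0 ->
  Lconst P theta Lip S = +oo%E \/
  exists l, [/\ 0 < l, Lconst P theta Lip S = l%:E
              & forall z, S z -> gamma z * LG <= l].
Proof.
move=> Su0; have := Lconst_ub Su0; have := @Lconst_ub S.
case: (Lconst P theta Lip S) => [l h|_ _|_].
- rewrite lee_fin => l0; right; exists l.
  have l_gt0 : 0 < l.
    by apply: lt_le_trans l0; rewrite mulr_gt0 ?hgamma ?constraints_lip_gt0.
  by split; [exact: l_gt0|exact: erefl|move=> z /h; rewrite lee_fin].
- by left.
- by rewrite leeNy_eq.
Qed.

Lemma sub_Phi : D0 `<=` Phi P theta Lip D0.
Proof.
move=> v Dv; apply: sub_conv_hull; exists v, 0; split=> //.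
  rewrite inve_ge0; apply: le_trans (Lconst_ub (u0_in_ball Du0)).
  by rewrite lee_fin mulr_ge0 ?gamma_ge0 ?constraints_lip_ge0.
by rewrite scale0r addr0 eproj_id//; case: Dv.
Qed.

(** Both ends of the trial step are generators of Phi(D0), with beta = 0 and
    beta = 1/l; the latter is in range because L(D0) <= L(Phi(D0)). *)
Lemma Phi_trial_step v l : D0 v -> 0 < l -> LPhi = l%:E ->
  forall t : R, 0 <= t -> t <= 1 ->
    gamma (v + t *: (eproj D (v + l^-1 *: gradd v) - v)) * LG <= l.
Proof.
move=> Dv l0 lE t t0 t1; rewrite -lee_fin -lE; apply: Lconst_ub.
have [|[l' [l'0 l'E hl']]] := Lconst_cases (u0_in_ball Du0).
  have : (Lconst P theta Lip D0 <= l%:E)%E.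
    rewrite -lE; apply: le_ereal_sup => _ [z Dz <-].
    by exists z => //; apply: sub_Phi.
  by move=> + E; rewrite E leye_eq.
have l'l : l' <= l.
  rewrite -lee_fin -l'E -lE; apply: le_ereal_sup => _ [z Dz <-].
  by exists z => //; apply: sub_Phi.
apply: conv_hull_segment => //.
  exists v, 0; split=> //; last by rewrite scale0r addr0 eproj_id//; case: Dv.
  by rewrite l'E inver gt_eqF// lee_fin invr_ge0 ltW.
exists v, l^-1; split=> //; first by rewrite invr_ge0 ltW.
by rewrite l'E inver gt_eqF// lee_fin lef_pV2 ?posrE.
Qed.

Hypothesis mp_neq0 : (m + p)%N <> 0%N.
Hypothesis alpha0 : 0 < alpha.
Hypothesis R0_gt0 : 0 < R0.
Hypothesis halpha : (alpha%:E < if (etaD%:E < LPsi)%E then 2%:E / LPsi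
              else (4 * (etaD^-1 - fine LPsi / (2 * etaD ^+ 2)))%:E)%E.

(** An infinite L(Psi(D0)) would turn the condition on alpha into alpha < 0. *)
Lemma LPsi_finite : exists l, [/\ 0 < l, LPsi = l%:E,
  forall z, Psi P theta ut D0 z -> gamma z * LG <= l &
  if etaD < l then alpha < 2 / l
  else alpha < 4 * (etaD^-1 - l / (2 * etaD ^+ 2))].
Proof.
have [lE|[l [l0 lE hl]]] := Lconst_cases (sub_Psi ut (u0_in_ball Du0)).
  move: halpha; rewrite /LPsi lE ltry invey mule0 lte_fin.
  by rewrite ltNge ltW.
exists l; split=> //; move: halpha; rewrite /LPsi lE lte_fin inver gt_eqF//.
by case: ifP.
Qed.

Let rho := (sup [set enorm (gradd v) | v in D0] + enorm (u0 - us) / alpha) ^+ 2.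
Let delta := alpha^-1 - fine LPsi / 2.
Let rate (k : nat) := R0 / (1 + k%:R * R0 * delta * rho^-1).

Let u0us : dualf u0 < dualf us.
Proof. by rewrite -subr_gt0 -dstarE. Qed.

Theorem projected_gradient_rates :
  [/\ has_ubound [set enorm (gradd v) | v in D0] /\ 0 < rho,
      LPsi \is a fin_num /\ 0 < delta
    & forall k : nat,
      [/\ dstar P - dualf (u k) <= rate k,
          enorm (xbar (u k) - xstar P) <= Num.sqrt (2 * theta^-1 * rate k),
          ((f (xbar (u k)) - fstar P)%:E <=
             (enorm us + enorm (u0 - us))%:E
             * sqrte ((2 * (m + p)%:R)%:E * LPhi * (rate k)%:E)
             + (rate k)%:E)%E,
          (- ((enorm us)%:E * sqrte (2%:E * LPhi * (rate k)%:E))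
             <= (f (xbar (u k)) - fstar P)%:E)%E
        & ((infeas P (xbar (u k)))%:E
             <= sqrte (2%:E * LPhi * (rate k)%:E))%E]].
Proof.
have [l [l0 lE hl hal]] := LPsi_finite.
have dE : delta = alpha^-1 - l / 2 by rewrite /delta lE.
have delta0 : 0 < delta by rewrite dE; apply: step_size_small hal.
have rho0 : 0 < rho by apply: rho_gt0.
split; [by split=> //; apply: has_ubound_gradd|by rewrite lE|move=> k].
have rk : dualf us - dualf (u k) <= rate k.
  have := @dual_rate ut u0 hut_neg Du0 l alpha hl l0 alpha0 hal u hu_init hu_step u0us k.
  by rewrite /rate dE /R0 dstarE.
have Dk : D0 (u k) by apply: (@iterates_ball ut u0 hut_neg Du0 l alpha hl).
have rate0 : 0 < rate k.
  by rewrite divr_gt0// ltr_pwDl// !mulr_ge0// ?invr_ge0 ltW.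
have gap0 : 0 <= dualf us - dualf (u k) by rewrite subr_ge0; apply: hus.2; case: Dk.
have infeasE : ((infeas P (xbar (u k)))%:E <= sqrte (2%:E * LPhi * (rate k)%:E))%E.
  have [lpE|[lp [lp0 lpE _]]] := Lconst_cases (sub_Phi (u0_in_ball Du0)).
    by rewrite /LPhi lpE gt0_muley ?lte_fin// gt0_mulye ?lte_fin//= leey.
  rewrite /LPhi lpE -!EFinM /= lee_fin.
  rewrite -[leLHS]ger0_norm ?sqrtr_ge0// -sqrtr_sqr ler_wsqrtr//.
  apply: le_trans (infeas_sqr_le Dk.1 lp0 (Phi_trial_step Dk lp0 lpE)) _.
  by rewrite ler_wpM2l// mulr_ge0// ltW.
have us_bound : enorm (u k) <= enorm us + enorm (u0 - us).
  have := enorm_distD us (u k) 0; rewrite !subr0 addrC => /le_trans; apply.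
  by rewrite lerD2l Dk.2.
split=> //.
- by rewrite dstarE.
- rewrite -[leLHS]ger0_norm// -sqrtr_sqr ler_wsqrtr//.
  have := le_trans (xbar_xstar_dist Dk.1) rk; set e := enorm _ ^+ 2 => h.
  rewrite mulrAC ler_pdivlMr//; lra.
- rewrite fstarE.
  have [lpE|[lp [lp0 lpE _]]] := Lconst_cases (sub_Phi (u0_in_ball Du0)).
    have mp0 : (0 < m + p)%N by rewrite lt0n; apply/eqP.
    have c0 : 0 < enorm us + enorm (u0 - us).
      rewrite ltr_wpDl// enorm_gt0// subr_eq0; apply/eqP => e.
      by move: u0us; rewrite e ltxx.
    rewrite /LPhi lpE gt0_muley ?lte_fin ?mulr_gt0 ?ltr0n//.
    by rewrite gt0_mulye ?lte_fin//= gt0_muley ?lte_fin// addye// leey.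
  rewrite /LPhi lpE -!EFinM /= -EFinD lee_fin.
  have := f_xbar_le Dk.1 lp0 (Phi_trial_step Dk lp0 lpE) => h.
  set x := dualf us - dualf (u k) in rk gap0 h.
  have y0 : 0 <= 2 * (m + p)%:R * lp * rate k.
    by apply: mulr_ge0 (ltW rate0); rewrite !mulr_ge0// ltW.
  have hs : enorm (u k) * Num.sqrt (2 * lp * x) <=
      (enorm us + enorm (u0 - us)) * Num.sqrt (2 * (m + p)%:R * lp * rate k).
    apply: ler_pM => //.
    rewrite ler_sqrt// -!mulrA ler_pM2l// mulrCA ler_pM2l//.
    apply: le_trans rk _; rewrite ler_peMl ?(ltW rate0)// ler1n lt0n.
    exact/eqP/mp_neq0.
  lra.
- rewrite fstarE; apply: (@le_trans _ _ (- (enorm us * infeas P (xbar (u k))))%:E).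
    by rewrite EFinN leeN2 EFinM lee_wpmul2l// lee_fin.
  by rewrite lee_fin; have := f_xbar_ge (u k); lra.
Qed.

End Conclusion.

End Optimum.
End DualFunction.

Unset Implicit Arguments.

Theorem theorem4p3 (R : realType) (n m p : nat) (P : problem R n m p)
  (theta : R) (Lip : 'I_m -> R) (ut : 'cV[R]_(m + p))
  (hX : closed (pX P) /\ convex_set (pX P))
  (hf : strongly_convex (pX P) (pf P) theta)
  (hf_closed : closed_on (pX P) (pf P))
  (hg : forall i, [/\ convex_function (pX P) (pg P i), 0 < Lip i
                    & lipschitz_over (pX P) (pg P i) (Lip i)])
  (hslater : exists x, [/\ relint (pX P) x, forall i, pg P i x < 0
                         & pA P *m x + pb P = 0])
  (hmp : (m + p)%N <> 0%N)
  (hA : p <> 0%N -> pA P <> 0)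
  (hg_diff : forall i x, pX P x -> differentiable (pg P i) x)
  (hut_neg : forall i, usubmx ut i 0 < 0)
  (hut_sc : exists thetat : R,
              strongly_convex (pX P) (fun x => Lagr P x ut) thetat)
  (hgamma : forall u, Dset u -> 0 < gamma_const P theta u)
  (u0 ustar : 'cV[R]_(m + p)) (u : nat -> 'cV[R]_(m + p)) (alpha : R)
  (hu0 : Dset u0) (hustar : Dstar P ustar)
  (hu_init : u 0%N = u0)
  (hu_step : forall k, u k.+1 = eproj Dset (u k + alpha *: gradd P (u k))) :
  let D0 := [set v | Dset v /\ enorm (v - ustar) <= enorm (u0 - ustar)] in
  let R0 := dstar P - dualf P u0 in
  let LPsi := Lconst P theta Lip (Psi P theta ut D0) in
  let LPhi := Lconst P theta Lip (Phi P theta Lip D0) in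
  let etaD := eta_const P theta ut D0 in
  let rho := (sup [set enorm (gradd P v) | v in D0]
              + enorm (u0 - ustar) / alpha) ^+ 2 in
  let delta := alpha^-1 - fine LPsi / 2 in
  let rate (k : nat) := R0 / (1 + k%:R * R0 * delta * rho^-1) in
  0 < R0 ->
  0 < alpha ->
  (alpha%:E < if (etaD%:E < LPsi)%E then 2%:E / LPsi
              else (4 * (etaD^-1 - fine LPsi / (2 * etaD ^+ 2)))%:E)%E ->
  [/\ has_ubound [set enorm (gradd P v) | v in D0] /\ 0 < rho,
      LPsi \is a fin_num /\ 0 < delta
    & forall k : nat,
      [/\ dstar P - dualf P (u k) <= rate k,
          enorm (xbar P (u k) - xstar P) <= Num.sqrt (2 * theta^-1 * rate k),
          ((pf P (xbar P (u k)) - fstar P)%:E <=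
             (enorm ustar + enorm (u0 - ustar))%:E
             * sqrte ((2 * (m + p)%:R)%:E * LPhi * (rate k)%:E)
             + (rate k)%:E)%E,
          (- ((enorm ustar)%:E * sqrte (2%:E * LPhi * (rate k)%:E))
             <= (pf P (xbar P (u k)) - fstar P)%:E)%E
        & ((infeas P (xbar P (u k)))%:E
             <= sqrte (2%:E * LPhi * (rate k)%:E))%E]].
Proof.
move=> D0 R0 LPsi LPhi etaD rho delta rate R0_gt0 alpha0 halpha.
have X0 : pX P !=set0 by have [x [[Xx _] _ _]] := hslater; exists x.
exact: (projected_gradient_rates hX hf hf_closed hg hg_diff X0 hustar hut_neg
  hgamma hu0 hu_init hu_step hmp alpha0 R0_gt0 halpha).
Qed.
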